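(* Let $K=\mathbb{Q}(\sqrt{p},\sqrt{q})$ be any real biquadratic field, with ring of integers $\mathcal{O}_K$. Then there exists a classical quadratic form in $2$ variables over $\mathcal{O}_K$ which is additively indecomposable.
   Context: A real biquadratic field is $K=\mathbb{Q}(\sqrt{p},\sqrt{q})$ with $p,q>1$ distinct square-free integers. An element of $K$ is totally positive if all its images under the real embeddings of $K$ are positive; $\mathcal{O}_K^+$ denotes the set of totally positive elements of $\mathcal{O}_K$. A quadratic form over $\mathcal{O}_K$ in $n$ variables is $Q(x_1,\dots,x_n)=\sum_{1\le i\le j\le n}a_{ij}x_ix_j$ with $a_{ij}\in\mathcal{O}_K$; it is classical if $a_{ij}\in 2\mathcal{O}_K$ for all $i\neq j$. $Q$ is totally positive semi-definite if $Q(x)\in\mathcal{O}_K^+\cup\{0\}$ for all $x\in\mathcal{O}_K^n$, and totally positive definite if moreover $Q(x)=0$ only for $x=0$. A totally positive definite classical form $Q$ is additively indecomposable if it cannot be written as $Q=Q_1+Q_2$ with $Q_1,Q_2$ nonzero classical totally positive semi-definite quadratic forms over $\mathcal{O}_K$ in the same $n$ variables. *)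

(* Defs.v *)
From HB Require Import structures.
From mathcomp Require Import all_boot all_order all_algebra all_field.
From mathcomp Require Import reals.

Set Implicit Arguments.
Unset Strict Implicit.
Unset Printing Implicit Defensive.

Import GRing.Theory Num.Theory.
Local Open Scope ring_scope.

Definition squarefree (n : nat) : Prop := forall d : nat, (d ^ 2 %| n)%N -> d = 1%N.

(* The field is given up to isomorphism, by square roots of p and q generating
   it over the rationals. *)
Definition real_biquadratic (p q : nat) (K : fieldExtType rat) : Prop :=
  [/\ (1 < p)%N /\ squarefree p, (1 < q)%N /\ squarefree q, p <> q
    & exists u v : K,
        [/\ u ^+ 2 = p%:R, v ^+ 2 = q%:R & <<1 & [:: u; v]>>%VS = fullv]].

Definition in_OK (K : fieldExtType rat) (x : K) : Prop :=
  integralOver (intr : int -> K) x.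

Definition totally_positive (R : realType) (K : fieldExtType rat) (x : K) : Prop :=
  forall sigma : {rmorphism K -> R}, 0 < sigma x.

Definition in_OKplus (R : realType) (K : fieldExtType rat) (x : K) : Prop :=
  in_OK x /\ totally_positive R x.

(* A form \sum_(i <= j) a_ij x_i x_j is represented by the upper triangular
   matrix of its coefficients (not by its Gram matrix), so that equality and
   addition of forms are those of matrices. *)
Definition quadratic_form (K : fieldExtType rat) (n : nat) (a : 'M[K]_n) : Prop :=
  (forall i j : 'I_n, (j < i)%N -> a i j = 0) /\
  (forall i j : 'I_n, (i <= j)%N -> in_OK (a i j)).

Definition qf_eval (K : fieldExtType rat) (n : nat) (a : 'M[K]_n)
    (x : 'I_n -> K) : K :=
  \sum_(i < n) \sum_(j < n | (i <= j)%N) a i j * x i * x j.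

Definition classical_form (K : fieldExtType rat) (n : nat) (a : 'M[K]_n) : Prop :=
  quadratic_form a /\
  forall i j : 'I_n, i <> j -> exists2 b : K, in_OK b & a i j = 2%:R * b.

Definition tot_pos_semidef (R : realType) (K : fieldExtType rat) (n : nat)
    (a : 'M[K]_n) : Prop :=
  forall x : 'I_n -> K, (forall i, in_OK (x i)) ->
    in_OKplus R (qf_eval a x) \/ qf_eval a x = 0.

Definition tot_pos_def (R : realType) (K : fieldExtType rat) (n : nat)
    (a : 'M[K]_n) : Prop :=
  tot_pos_semidef R a /\
  forall x : 'I_n -> K, (forall i, in_OK (x i)) ->
    qf_eval a x = 0 -> forall i, x i = 0.

Definition additively_indecomposable (R : realType) (K : fieldExtType rat)
    (n : nat) (a : 'M[K]_n) : Prop :=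
  [/\ classical_form a, tot_pos_def R a
    & ~ exists b c : 'M[K]_n,
        [/\ a = b + c,
            [/\ b <> 0, classical_form b & tot_pos_semidef R b]
          & [/\ c <> 0, classical_form c & tot_pos_semidef R c]]].

(* Main.v *)
Require Import Defs.
From HB Require Import structures.
From mathcomp Require Import all_boot all_order all_algebra all_field.
From mathcomp Require Import boolp reals.
From mathcomp Require Import zify ring lra.

Set Implicit Arguments.
Unset Strict Implicit.
Unset Printing Implicit Defensive.

Import Order.TTheory GRing.Theory Num.Theory.
Local Open Scope ring_scope.

(* If a is an indecomposable totally positive integer of K and not a unit, take
   c of minimal trace among the integers above 1/a; then the form
   a x^2 + 2 x y + c y^2 is indecomposable, for one summand must have leading
   coefficient 0, hence be c' y^2, and subtracting c' from c would contradict
   minimality.  Likewise 2 x^2 + 2 b x y + c y^2 is indecomposable when its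
   determinant is a totally positive unit that is not a square, as 2 = 1 + 1 is
   the only decomposition of 2.

   Write the quadratic subfields as Q(sqrt n) with n = ab, ac, bc.  For k the
   least integer above sqrt n (odd, if n = 1 mod 4), the element k + sqrt n
   (halved, if n = 1 mod 4) has trace 1 against a totally positive element of
   the codifferent of Q(sqrt n), so in K it can only split into two conjugates
   of relative trace k + sqrt n, which bounds the other two radicands.  Choosing
   n suitably, this gives a non-unit indecomposable, or a non-square unit for the
   second construction, except when the radicands are 5, t and 5t with
   t = N^2 - 1.  In that case one multiplies by the golden ratio, of mixed
   signature, and applies the same functional argument to elements having the
   sign of sqrt 5 at every real place. *)

(** Units are the obstacle. If a is a unit, the minimal c is 1/a and the form collapses to the
    degenerate a (x + y/a)^2, so the first construction needs norm greater than 1. Over its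
    quadratic field, k + sqrt n has norm k^2 - n, and its half a quarter of that: units occur
    exactly for n = k^2 - 1 and n = k^2 - 4 respectively, and these two families drive the case
    analysis. For the radicands 5, t, 5t with t = N^2 - 1 every source dries up: (3 + sqrt 5)/2 is a
    unit and the square of the golden ratio, N + sqrt t is a unit, and for 5t both other radicands
    are too small to forbid a splitting. The golden ratio, itself a unit, preserves integers and
    non-units while exchanging one cone of sign patterns for another. In the new cone the coordinate
    on sqrt 5 replaces the rational one as the dominant coordinate, which gives fresh minimal
    elements. *)

(** * Integrality over the rational integers *)

Lemma ratr_integral (F : numFieldType) (x : rat) :
  integralOver (intr : int -> F) (ratr x) -> exists n : int, x = n%:~R.
Proof.
case=> f fmon /rootP fx0.
have fx : root (map_poly (intr : int -> rat) f) x.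
  apply/rootP/(fmorph_inj (ratr : rat -> F)); rewrite rmorph0 -horner_map -map_poly_comp /=.
  by rewrite -{}fx0; congr _.[_]; apply: eq_map_poly => n /=; rewrite ratr_int.
have : (ratr x : algC) \in Aint.
  apply: (@root_monic_Aint (map_poly (intr : int -> algC) f)).
  - move: fx => /rootP fx; apply/rootP.
    rewrite -[RHS](rmorph0 (ratr : rat -> algC)) -fx -horner_map -map_poly_comp /=.
    by congr _.[_]; apply: eq_map_poly => n /=; rewrite ratr_int.
  - exact: monic_map.
  - by apply/polyOverP => i; rewrite coef_map /= intr_int.
move/(Cint_rat_Aint (Crat_rat x)) => /intrP[n /eqP].
by rewrite -(ratr_int _ n) fmorph_eq /= => /eqP ->; exists n.
Qed.

Section Integers.

Variables (R : realType) (K : fieldExtType rat).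
Implicit Types x y : K.

Lemma in_OK_nat (n : nat) : in_OK (n%:R : K).
Proof. exact: integral_nat. Qed.

Lemma in_OKD x y : in_OK x -> in_OK y -> in_OK (x + y).
Proof. exact: integral_add. Qed.

Lemma in_OKB x y : in_OK x -> in_OK y -> in_OK (x - y).
Proof. exact: integral_sub. Qed.

Lemma in_OKN x : in_OK x -> in_OK (- x).
Proof. exact: integral_opp. Qed.

Lemma in_OKM x y : in_OK x -> in_OK y -> in_OK (x * y).
Proof. exact: integral_mul. Qed.

Lemma in_OKX x (k : nat) : in_OK x -> in_OK (x ^+ k).
Proof.
move=> xO; elim: k => [|k IH]; first exact: (in_OK_nat 1).
by rewrite exprS; apply: in_OKM.
Qed.

Lemma in_OK_quadratic x (t n : int) :
  x ^+ 2 = t%:~R * x - n%:~R -> in_OK x.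
Proof.
move=> xE; exists ('X ^+ 2 - t *: 'X + n%:P).
  rewrite monicE lead_coefE.
  have -> : size ('X^2 - t *: 'X + n%:P : {poly int}) = 3%N.
    rewrite -addrA size_polyDl ?size_polyXn //.
    apply: leq_trans (size_polyD _ _) _; rewrite geq_max size_polyN.
    rewrite (leq_trans (size_scale_leq _ _)) ?size_polyX //.
    by rewrite (leq_trans (size_polyC_leq1 _)).
  by rewrite !coefE /= mulr0 subr0 addr0.
apply/rootP.
rewrite rmorphD rmorphB /= rmorphXn /= map_polyZ map_polyX map_polyC /=.
by rewrite !hornerE xE; ring.
Qed.

Lemma rmorph_in_OK (sigma : {rmorphism K -> R}) x :
  in_OK x -> integralOver (intr : int -> R) (sigma x).
Proof.
case=> f fmon /rootP fx; exists f => //; apply/rootP.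
rewrite -[RHS](rmorph0 sigma) -fx -horner_map -map_poly_comp /=.
by congr _.[_]; apply: eq_map_poly => n /=; rewrite rmorph_int.
Qed.

Lemma in_OKplusD x y : in_OKplus R x -> in_OKplus R y -> in_OKplus R (x + y).
Proof.
case=> xO xp [yO yp]; split; first exact: in_OKD.
by move=> s; rewrite rmorphD addr_gt0.
Qed.

End Integers.

Definition indecomposable_integer (R : realType) (K : fieldExtType rat) (x : K) :
    Prop :=
  in_OKplus R x /\
  forall y z : K, in_OKplus R y -> in_OKplus R z -> x <> y + z.

(** What the two criteria need of the embeddings: the family exhausts them, and the sum and product
    over it act as trace and norm, which send integers of K to rational integers. *)
Definition full_embeddings (R : realType) (K : fieldExtType rat) (I : finType)
    (s : I -> {rmorphism K -> R}) : Prop :=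
  [/\ forall x, in_OK x -> exists n : int, \sum_i s i x = n%:~R,
      forall x, in_OK x -> exists n : int, \prod_i s i x = n%:~R
    & forall sigma : {rmorphism K -> R}, exists i, sigma =1 s i].

(** * Binary classical forms *)

Section BinaryForms.

Variables (R : realType) (K : fieldExtType rat).
Implicit Types (A B C x y : K) (sigma : {rmorphism K -> R}).

(** The form A x^2 + 2 B x y + C y^2; with the factor 2 built in, classical means that B is an
    integer. *)
Definition binary_form A B C : 'M[K]_2 :=
  \matrix_(i, j) if i == j then (if i == 0 then A else C)
                 else if i == 0 then 2%:R * B else 0.

Lemma ord2_cases (i : 'I_2) : i = 0 \/ i = 1.
Proof. by case: i => [[|[|//]] ?]; [left | right]; apply: val_inj. Qed.

Lemma qf_eval2 (b : 'M[K]_2) (v : 'I_2 -> K) :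
  qf_eval b v = b 0 0 * v 0 ^+ 2 + b 0 1 * v 0 * v 1 + b 1 1 * v 1 ^+ 2.
Proof.
rewrite /qf_eval big_ord_recl big_ord1.
rewrite !(big_mkcond (fun j : 'I_2 => (_ <= j)%N)) /=.
rewrite !big_ord_recl !big_ord0 /= !addr0 add0r.
have -> : lift ord0 ord0 = 1 :> 'I_2 by apply: val_inj.
have -> : ord0 = 0 :> 'I_2 by apply: val_inj.
by ring.
Qed.

Lemma natK_neq0 (n : nat) : (n.+1%:R : K) != 0.
Proof.
have -> : (n.+1%:R : K) = (n.+1%:R : rat) *: 1 by rewrite scaler_nat.
by rewrite scaler_eq0 oner_eq0 orbF pnatr_eq0.
Qed.

Definition pair_fun x y : 'I_2 -> K := fun i => if i == 0 then x else y.

Lemma binary_form_eval A B C (v : 'I_2 -> K) :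
  qf_eval (binary_form A B C) v =
    A * v 0 ^+ 2 + 2%:R * B * v 0 * v 1 + C * v 1 ^+ 2.
Proof. by rewrite qf_eval2 !mxE. Qed.

Lemma binary_form_inj A B C A' B' C' :
  binary_form A B C = binary_form A' B' C' -> [/\ A = A', B = B' & C = C'].
Proof.
move/matrixP => E; have := E 0 0; have := E 0 1; have := E 1 1.
rewrite !mxE /= => -> eB ->; split=> //.
exact: (mulfI (natK_neq0 1) eB).
Qed.

Lemma binary_formD A B C A' B' C' :
  binary_form A B C + binary_form A' B' C' =
    binary_form (A + A') (B + B') (C + C').
Proof.
apply/matrixP => i j; rewrite !mxE.
by case: eqP => _; case: eqP => _; rewrite ?mulrDr ?addr0.
Qed.

Lemma binary_form0 : binary_form 0 0 0 = 0.
Proof.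
apply/matrixP => i j; rewrite !mxE.
by case: eqP => _; case: eqP => _; rewrite ?mulr0.
Qed.

Lemma classical_binary_form A B C :
  in_OK A -> in_OK B -> in_OK C -> classical_form (binary_form A B C).
Proof.
move=> AO BO CO.
have O0 : in_OK (0 : K) := in_OK_nat K 0.
have BO2 : in_OK (2%:R * B) by apply: in_OKM => //; apply: in_OK_nat.
split; [split|] => i j; rewrite mxE.
- case: (ord2_cases i) => ->; case: (ord2_cases j) => -> //=.
- by move=> _; case: eqP => _; case: eqP.
- move=> /eqP/negbTE ->; case: eqP => _; first by exists B.
  by exists 0; rewrite ?mulr0.
Qed.

Lemma classical_binaryP (b : 'M[K]_2) : classical_form b ->
  exists A B C, [/\ in_OK A, in_OK B, in_OK C & b = binary_form A B C].
Proof.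
case=> [[bT bO] b2]; have [|B BO bB] := b2 0 1; first by move/(congr1 val).
exists (b 0 0), B, (b 1 1); split; [exact: bO | done | exact: bO |].
apply/matrixP => i j; rewrite mxE.
case: (ord2_cases i) => ->; case: (ord2_cases j) => -> //=.
exact: bT.
Qed.

Lemma semidef_values A B C x y :
  tot_pos_semidef R (binary_form A B C) -> in_OK x -> in_OK y ->
  let v := A * x ^+ 2 + 2%:R * B * x * y + C * y ^+ 2 in
  in_OKplus R v \/ v = 0.
Proof.
move=> psd xO yO /=; have := psd (pair_fun x y); rewrite binary_form_eval.
by apply=> i; rewrite /pair_fun; case: eqP.
Qed.

Lemma in_OKplus_or0_ge0 x sigma : in_OKplus R x \/ x = 0 -> 0 <= sigma x.
Proof. by case=> [[_ /(_ sigma)/ltW //] | ->]; rewrite rmorph0. Qed.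

Lemma semidef_fst A B C : tot_pos_semidef R (binary_form A B C) ->
  in_OKplus R A \/ A = 0.
Proof.
move=> /semidef_values/(_ (in_OK_nat K 1) (in_OK_nat K 0)) /=.
by rewrite expr1n mulr1 mulr0 expr0n /= mulr0 !addr0.
Qed.

Lemma semidef_snd A B C : tot_pos_semidef R (binary_form A B C) ->
  in_OKplus R C \/ C = 0.
Proof.
move=> /semidef_values/(_ (in_OK_nat K 0) (in_OK_nat K 1)) /=.
by rewrite expr1n expr0n /= !mulr0 mul0r mulr1 !add0r.
Qed.

(** Without an x^2 term the value at (- k B, 1) is C - 2 k B^2, which is negative under [sigma] for
    large k unless B = 0. *)
Lemma semidef_offdiag0 B C sigma :
  in_OK B -> tot_pos_semidef R (binary_form 0 B C) -> B = 0.
Proof.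
move=> BO psd; apply/eqP/negPn/negP => B0.
have sB : sigma B != 0 by rewrite fmorph_eq0.
pose k := Num.bound (sigma C / (2%:R * sigma B ^+ 2)).
have sB2 : 0 < 2%:R * sigma B ^+ 2.
  by rewrite mulr_gt0 ?ltr0n // exprn_even_gt0 //= sB.
have /(in_OKplus_or0_ge0 sigma) /= := semidef_values psd
  (in_OKN (in_OKM (in_OK_nat K k) BO)) (in_OK_nat K 1).
have : sigma C < k%:R * (2%:R * sigma B ^+ 2).
  rewrite -ltr_pdivrMr //; apply: le_lt_trans (archi_boundP _); last first.
    exact: divr_ge0 (in_OKplus_or0_ge0 _ (semidef_snd psd)) (ltW sB2).
  exact: lexx.
rewrite !(rmorphD, rmorphM, rmorphN, rmorphXn, rmorph0, rmorph_nat) /=.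
by move=> *; lra.
Qed.

(** This is the value of the form at (- B, A). *)
Lemma semidef_det A B C :
  in_OK A -> in_OK B -> tot_pos_semidef R (binary_form A B C) ->
  in_OKplus R (A * (A * C - B ^+ 2)) \/ A * (A * C - B ^+ 2) = 0.
Proof.
move=> AO BO psd; have /= := semidef_values psd (in_OKN BO) AO.
suff -> : A * (- B) ^+ 2 + 2%:R * B * - B * A + C * A ^+ 2
  = A * (A * C - B ^+ 2) by [].
by ring.
Qed.

Lemma binary_form_def A B C sigma0 :
  in_OK A -> in_OK B -> in_OK C ->
  totally_positive R A -> totally_positive R (A * C - B ^+ 2) ->
  tot_pos_def R (binary_form A B C).
Proof.
move=> AO BO CO Ap Dp.
have key v : (forall i, in_OK (v i)) ->
    qf_eval (binary_form A B C) v = 0 /\ (forall i, v i = 0) \/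
    totally_positive R (qf_eval (binary_form A B C) v).
  move=> vO; rewrite binary_form_eval.
  have AE : A * (A * v 0 ^+ 2 + 2%:R * B * v 0 * v 1 + C * v 1 ^+ 2) =
    (A * v 0 + B * v 1) ^+ 2 + (A * C - B ^+ 2) * v 1 ^+ 2 by ring.
  have [v1|v1] := eqVneq (v 1) 0; last first.
    right=> s; rewrite -(pmulr_rgt0 _ (Ap s)) -rmorphM AE.
    rewrite rmorphD [in X in _ + X]rmorphM !rmorphXn /=.
    apply: ltr_wpDl; first exact: sqr_ge0.
    by apply: mulr_gt0 => //; rewrite exprn_even_gt0 //= fmorph_eq0.
  rewrite v1 expr0n /= !mulr0 !addr0.
  have [v0|v0] := eqVneq (v 0) 0.
    left; split; first by rewrite v0 expr0n /= mulr0.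
    by move=> i; case: (ord2_cases i) => ->.
  by right=> s; rewrite rmorphM rmorphXn mulr_gt0 // exprn_even_gt0 //= fmorph_eq0.
split=> v vO; last first.
  move=> e0; case: (key v vO) => [[]//|/(_ sigma0)].
  by rewrite e0 rmorph0 ltxx.
case: (key v vO) => [[-> _]|p]; [by right | left; split=> //].
rewrite binary_form_eval.
have O2 := in_OK_nat K 2.
by repeat first [exact: vO | assumption | apply: in_OKX | apply: in_OKD | apply: in_OKM].
Qed.

End BinaryForms.

(** * Two sources of indecomposable forms: non-unit indecomposable integers and non-square units *)

Section Criteria.

Variables (R : realType) (K : fieldExtType rat) (I : finType) (i0 : I).
Variable s : I -> {rmorphism K -> R}.
Hypothesis sP : full_embeddings s.
Implicit Types (a b c d x y : K).

Lemma full_embeddings_pos x : (forall i, 0 < s i x) -> totally_positive R x.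
Proof. by case: sP => _ _ H p sigma; have [i ->] := H sigma. Qed.

Lemma norm_ge1 x : in_OKplus R x -> 1 <= \prod_i s i x.
Proof.
case: sP => _ N _ [xO xp]; have [n nE] := N x xO.
have : 0 < \prod_i s i x by apply: prodr_gt0 => i _; apply: xp.
by rewrite nE ltr0z ler1z; lia.
Qed.

Lemma trace_gt0 x : in_OKplus R x -> exists n : nat, \sum_i s i x = n.+1%:R.
Proof.
case: sP => T _ _ [xO xp]; have [n nE] := T x xO.
have : 0 < \sum_i s i x.
  by rewrite (bigD1 i0) //= ltr_pwDl // sumr_ge0 // => i _; apply/ltW/xp.
by rewrite nE ltr0z; case: n nE => [[|n]|n] // nE _; exists n.
Qed.

(** Descent on the trace, which is a positive rational integer on totally positive integers and
    drops from x to x - y. *)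
Lemma integers_above_minimal (S : K -> Prop) :
  (forall x, S x -> in_OKplus R x) -> (exists x, S x) ->
  exists2 x, S x & forall y, in_OKplus R y -> ~ S (x - y).
Proof.
move=> SO [x Sx]; have [n nE] := trace_gt0 (SO x Sx).
elim/ltn_ind: n x Sx nE => n IH x Sx nE.
case: (EM (exists2 y, in_OKplus R y & S (x - y))) => [[y yO Sy]|N]; last first.
  by exists x => // y yO Sy; apply: N; exists y.
have [k kE] := trace_gt0 (SO _ Sy); have [l lE] := trace_gt0 yO.
apply: (IH k _ _ Sy kE); rewrite -ltnS -(ltr_nat R) -nE -kE.
under eq_bigr do rewrite rmorphB.
by rewrite sumrB lE ltrBlDr ltrDl ltr0n.
Qed.

Lemma indecomposable_form_of_integer a :
  indecomposable_integer R a -> ~ in_OK a^-1 ->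
  exists q : 'M[K]_2, additively_indecomposable R q.
Proof.
move=> [[aO ap] aI] aU.
have a0 : a != 0 by rewrite -(fmorph_eq0 (s i0)) gt_eqF.
pose S c := in_OK c /\ forall sigma : {rmorphism K -> R}, 1 <= sigma (a * c).
have SO c : S c -> in_OKplus R c.
  case=> cO cp; split=> // sigma; rewrite -(pmulr_rgt0 _ (ap sigma)) -rmorphM.
  exact: lt_le_trans ltr01 (cp sigma).
have [|c [cO cp] cmin] := integers_above_minimal SO.
  pose B := \sum_i (s i a)^-1; pose k := Num.bound B.
  have kB : B < k%:R.
    by apply: archi_boundP; apply: sumr_ge0 => i _; rewrite invr_ge0 ltW.
  exists k%:R; split=> [|sigma]; first exact: in_OK_nat.
  have [_ _ /(_ sigma)[i sE]] := sP; rewrite sE rmorphM rmorph_nat.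
  rewrite mulrC -ler_pdivrMr // mul1r; apply/ltW/(le_lt_trans _ kB).
  by rewrite /B (bigD1 i) //= lerDl sumr_ge0 // => j _; rewrite invr_ge0 ltW.
(* Equality a c = 1 at a single place would give c = 1/a, an integer; this is where a must not be a
   unit. *)
have Dp : totally_positive R (a * c - 1 ^+ 2).
  move=> sigma; rewrite expr1n rmorphB rmorph1 subr_gt0 lt_neqAle cp andbT.
  apply/eqP => e; apply: aU; suff <- : c = a^-1 by [].
  apply: (mulfI a0); rewrite mulfV //; apply: (fmorph_inj sigma).
  by rewrite rmorph1.
exists (binary_form a 1 c); split.
- by apply: classical_binary_form => //; apply: (in_OK_nat K 1).
- by apply: (binary_form_def (s i0)) => //; apply: (in_OK_nat K 1).
have main b1 c1 a2 b2 c2 : in_OK b1 -> in_OK b2 -> in_OK c1 ->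
    binary_form a 1 c = binary_form a b1 c1 + binary_form a2 b2 c2 -> a2 = 0 ->
    tot_pos_semidef R (binary_form a b1 c1) ->
    tot_pos_semidef R (binary_form a2 b2 c2) -> binary_form a2 b2 c2 = 0.
  rewrite binary_formD => b1O b2O c1O /binary_form_inj[_ bE cE] a20 psd1 psd2.
  subst a2; have b20 := semidef_offdiag0 (s i0) b2O psd2.
  rewrite b20 addr0 in bE; subst b1.
  (* Once c2 y^2 is removed, semi-definiteness still gives a (c - c2) >= 1 everywhere, so c - c2
     would again lie in [S]. *)
  have [c2p|->] := semidef_snd psd2; last by rewrite b20 binary_form0.
  case: (cmin c2 c2p); rewrite cE addrK; split=> // sigma.
  have := in_OKplus_or0_ge0 sigma (semidef_det aO b1O psd1).
  by rewrite rmorphM (pmulr_rge0 _ (ap sigma)) rmorphB expr1n rmorph1 subr_ge0.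
case=> q1 [q2 [qE [q10 q1c q1p] [q20 q2c q2p]]].
have [a1 [b1 [c1 [a1O b1O c1O q1E]]]] := classical_binaryP q1c.
have [a2 [b2 [c2 [a2O b2O c2O q2E]]]] := classical_binaryP q2c.
subst q1 q2; have := qE; rewrite binary_formD => /binary_form_inj[aE _ _].
case: (semidef_fst q1p) (semidef_fst q2p) => [a1p|a10] [a2p|a20].
- exact: aI aE.
- rewrite a20 addr0 in aE; subst a1.
  exact: q20 (main _ _ _ _ _ b1O b2O c1O qE a20 q1p q2p).
- rewrite a10 add0r in aE; subst a2; rewrite addrC in qE.
  exact: q10 (main _ _ _ _ _ b2O b1O c2O qE a10 q2p q1p).
- by rewrite a10 a20 addr0 in aE; rewrite aE eqxx in a0.
Qed.

(** At every place x y = 1 - (x - 1)^2 <= 1, while the norm of x y is at least 1; so x - 1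
    vanishes. *)
Lemma two_decomposition x y :
  in_OKplus R x -> in_OKplus R y -> x + y = 2%:R -> x = 1.
Proof.
move=> [xO xp] [yO yp] xy2.
have xyE i : s i x * s i y = 1 - (s i x - 1) ^+ 2.
  have -> : s i y = 2 - s i x by rewrite -(rmorph_nat (s i)) -xy2 rmorphD; ring.
  by ring.
have N : 1 <= \prod_i s i (x * y).
  by apply: norm_ge1; split=> [|sigma]; [exact: in_OKM | rewrite rmorphM mulr_gt0].
apply: (fmorph_inj (s i0)); rewrite rmorph1; apply/eqP; rewrite -subr_eq0.
apply/negPn/negP => n0; move: N; apply/negP; rewrite -ltNge (bigD1 i0) //=.
have lt1 : s i0 (x * y) < 1.
  by rewrite rmorphM xyE ltrBlDr ltrDl exprn_even_gt0.
apply: le_lt_trans lt1; apply: ler_piMr; first by rewrite rmorphM mulr_ge0 ?ltW.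
apply: prodr_ile1 => i _; rewrite rmorphM; apply/andP; split.
  by rewrite mulr_ge0 ?ltW.
by rewrite xyE lerBlDr lerDl sqr_ge0.
Qed.

(** The norm of g is at least 1 and that of the unit d at most 1, so g cannot be at most d/2 at all
    places. *)
Lemma unit_not_ge_double d g : in_OKplus R d -> in_OK d^-1 ->
  in_OKplus R g -> ~ (forall i, 2%:R * s i g <= s i d).
Proof.
move=> [dO dp] dU gO le.
have N1 : \prod_i s i d <= 1.
  have : 1 <= \prod_i s i d^-1.
    apply: norm_ge1; split=> // sigma; rewrite fmorphV invr_gt0; exact: dp.
  under eq_bigr do rewrite fmorphV.
  by rewrite prodfV invf_ge1 // prodr_gt0 // => i _; apply: dp.
have := norm_ge1 gO; have [_ gp] := gO; apply/negP; rewrite -ltNge.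
apply: lt_le_trans N1; apply: ltr_prod => [|i _].
  by apply/hasP; exists i0; rewrite ?mem_index_enum.
rewrite ltW ?gp //=; apply: lt_le_trans (le i).
by rewrite ltr_pMl ?gp // ltr1n.
Qed.

Lemma indecomposable_form_of_unit d b :
  in_OKplus R d -> in_OK d^-1 -> in_OK b -> in_OK ((d + b ^+ 2) / 2%:R) ->
  (forall x, d <> x ^+ 2) -> exists q : 'M[K]_2, additively_indecomposable R q.
Proof.
move=> dO dU bO cO dS; set c := _ / _ in cO.
have two0 := natK_neq0 K 1.
have dE : d = 2%:R * c - b ^+ 2 by rewrite /c mulrC divfK // addrK.
have O1 := in_OK_nat K 1; have O2 := in_OK_nat K 2.
exists (binary_form 2%:R b c); split; first exact: classical_binary_form.
  apply: (binary_form_def (s i0)) => //; last by rewrite -dE; case: dO.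
  by move=> sigma; rewrite rmorph_nat ltr0n.
have no_summand b' c' g : in_OK b' ->
    binary_form 2%:R b c = binary_form 2%:R b' c' + binary_form 0 0 g ->
    tot_pos_semidef R (binary_form 2%:R b' c') ->
    tot_pos_semidef R (binary_form 0 0 g) -> binary_form (0 : K) 0 g = 0.
  rewrite binary_formD => b'O /binary_form_inj[_ bE cE] psd1 psd2.
  rewrite addr0 in bE; subst b'.
  have [gp|->] := semidef_snd psd2; last by rewrite binary_form0.
  (* Here d = (2 c' - b^2) + 2 g, and semi-definiteness makes the bracket nonnegative. *)
  case: (unit_not_ge_double dO dU gp) => i.
  have := in_OKplus_or0_ge0 (s i) (semidef_det O2 bO psd1).
  rewrite rmorphM rmorph_nat pmulr_rge0 ?ltr0n //.
  rewrite dE cE !(rmorphB, rmorphD, rmorphM, rmorph_nat) /= => *; lra.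
case=> q1 [q2 [qE [q10 q1c q1p] [q20 q2c q2p]]].
have [a1 [b1 [c1 [a1O b1O c1O q1E]]]] := classical_binaryP q1c.
have [a2 [b2 [c2 [a2O b2O c2O q2E]]]] := classical_binaryP q2c.
subst q1 q2; have := qE; rewrite binary_formD => /binary_form_inj[aE bE cE].
case: (semidef_fst q1p) (semidef_fst q2p) => [a1p|a10] [a2p|a20].
- have a11 := two_decomposition a1p a2p (esym aE).
  have a21 : a2 = 1 by apply: two_decomposition a2p a1p _; rewrite addrC.
  subst a1 a2.
  have := semidef_det O1 b1O q1p; have := semidef_det O1 b2O q2p.
  rewrite !mul1r; set g1 := c1 - _; set g2 := c2 - _ => g2p g1p.
  (* With g1, g2 the determinants of the two summands, either g1 + g2 is totally positive and its
     double is at most d, or both vanish and d is a square. *)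
  have dE' : d = (b1 - b2) ^+ 2 + 2%:R * (g1 + g2).
    by rewrite dE bE cE /g1 /g2; ring.
  have nog g : in_OKplus R g -> g1 + g2 = g -> False.
    move=> gp gE; apply: (unit_not_ge_double dO dU gp) => i.
    by rewrite dE' gE rmorphD rmorphXn rmorphM rmorph_nat lerDr sqr_ge0.
  case: g1p g2p => [g1p|g10] [g2p|g20].
  + exact: nog (in_OKplusD g1p g2p) _.
  + by apply: nog g1p _; rewrite g20 addr0.
  + by apply: nog g2p _; rewrite g10 add0r.
  + by apply: (dS (b1 - b2)); rewrite dE' g10 g20 addr0 mulr0 addr0.
- have b20 := semidef_offdiag0 (s i0) b2O; rewrite a20 in q2p qE q20 b20.
  rewrite a20 addr0 in aE; rewrite -aE in q1p qE.
  have {}b20 := b20 _ q2p; rewrite b20 in q2p qE q20.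
  exact: q20 (no_summand _ _ _ b1O qE q1p q2p).
- have b10 := semidef_offdiag0 (s i0) b1O; rewrite a10 in q1p qE q10 b10.
  rewrite a10 add0r in aE; rewrite -aE in q2p qE.
  have {}b10 := b10 _ q1p; rewrite b10 in q1p qE q10; rewrite addrC in qE.
  exact: q10 (no_summand _ _ _ b2O qE q2p q1p).
- by move: aE; rewrite a10 a20 addr0; apply/eqP.
Qed.

End Criteria.

(** * Square-free radicands and the basis 1, e1, e2, e3 of a biquadratic field *)

(** The square of the denominator of t divides n. *)
Lemma squarefree_rat (n : nat) (t : rat) (k : int) :
  squarefree n -> n%:R * t ^+ 2 = k%:~R -> exists j : int, t = j%:~R.
Proof.
move=> nsq tE; exists (numq t).
suff d1 : denq t = 1 by rewrite -[LHS]divq_num_den d1 divr1.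
have dn0 : (denq t)%:~R != 0 :> rat by rewrite intr_eq0 denq_neq0.
have E : (n%:Z * numq t ^+ 2 = k * denq t ^+ 2)%R.
  apply: (@intr_inj rat); rewrite !(rmorphXn, rmorphM) /= -tE.
  have <- : t * (denq t)%:~R = (numq t)%:~R by rewrite numqE.
  by rewrite -pmulrn; ring.
have E' : (n * `|numq t| ^ 2 = `|k| * `|denq t| ^ 2)%N.
  by rewrite -!abszX -[n]/(`|n%:Z|)%N -!abszM E.
have dv : (`|denq t| ^ 2 %| n)%N.
  rewrite -(@Gauss_dvdl _ n (`|numq t| ^ 2)).
    by rewrite E' dvdn_mull.
  by rewrite coprimeXl // coprimeXr // coprime_sym coprime_num_den.
have := nsq _ dv; have := denq_gt0 t; lia.
Qed.

Lemma squarefree_irrational (n : nat) (x w : rat) :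
  squarefree n -> (1 < n)%N -> x ^+ 2 = n%:R * w ^+ 2 -> w = 0.
Proof.
move=> nsq n1 E; apply/eqP/negPn/negP => w0.
have E1 : (x / w) ^+ 2 = n%:R by rewrite expr_div_n E mulfK // expf_neq0.
have [||j jE] := @squarefree_rat 1 (x / w) n%:Z.
- by move=> d; rewrite dvdn1 => /eqP; case: d => [|[|]].
- by rewrite mul1r E1.
have nE : n = (`|j| ^ 2)%N.
  suff : (j ^+ 2 = n%:Z)%R by rewrite -abszX => ->.
  by apply: (@intr_inj rat); rewrite rmorphXn /= -jE E1.
have j1 : `|j|%N = 1%N by apply: nsq; rewrite -nE.
by move: n1; rewrite nE j1.
Qed.

Lemma squarefree_gt0 (n : nat) : squarefree n -> (0 < n)%N.
Proof. by case: n => // /(_ 2%N); rewrite dvdn0 => /(_ isT). Qed.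

Section Frame.

Variables (R : realType) (K : fieldExtType rat).

Definition lincomb (e1 e2 e3 : K) (x y z w : rat) : K :=
  x%:A + y *: e1 + z *: e2 + w *: e3.

(* The three quadratic subfields are generated by square roots e1, e2, e3 of
   ab, ac and bc; this presentation is symmetric under permutations. *)
Record frame (a b c : nat) (e1 e2 e3 : K) : Prop := Frame {
  frame_sqf12 : squarefree (a * b);
  frame_sqf13 : squarefree (a * c);
  frame_sqf23 : squarefree (b * c);
  frame_neq12 : a <> b;
  frame_neq13 : a <> c;
  frame_neq23 : b <> c;
  frame_e11 : e1 ^+ 2 = (a * b)%:R;
  frame_e22 : e2 ^+ 2 = (a * c)%:R;
  frame_e33 : e3 ^+ 2 = (b * c)%:R;
  frame_e12 : e1 * e2 = a%:R * e3;
  frame_e13 : e1 * e3 = b%:R * e2;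
  frame_e23 : e2 * e3 = c%:R * e1;
  frame_span : forall v : K, exists x y z w, v = lincomb e1 e2 e3 x y z w }.

Lemma frame_swap12 a b c e1 e2 e3 :
  frame a b c e1 e2 e3 -> frame b a c e1 e3 e2.
Proof.
case=> *; split=> //; try by rewrite mulnC.
- exact: nesym.
- by rewrite mulrC.
- move=> v; have [x [y [z [w ->]]]] : exists x y z w, v = lincomb e1 e2 e3 x y z w by [].
  by exists x, y, w, z; rewrite /lincomb -!addrA [_ *: e2 + _]addrC.
Qed.

Lemma frame_swap23 a b c e1 e2 e3 :
  frame a b c e1 e2 e3 -> frame a c b e2 e1 e3.
Proof.
case=> *; split=> //; try by rewrite mulnC.
- exact: nesym.
- by rewrite mulrC.
- move=> v; have [x [y [z [w ->]]]] : exists x y z w, v = lincomb e1 e2 e3 x y z w by [].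
  by exists x, z, y, w; rewrite /lincomb -!addrA; congr (_ + _); rewrite addrCA.
Qed.

End Frame.

Section RationalSpan.

Variables (L : fieldType) (i : {rmorphism rat -> L}) (a b c : nat) (f1 f2 f3 : L).
Implicit Types x y z w : rat.

(** The target field is arbitrary so that one multiplication table serves both K and its images in
    the reals. *)
Definition rational_comb x y z w : L := i x + i y * f1 + i z * f2 + i w * f3.

Definition frame_relations : Prop :=
  [/\ f1 ^+ 2 = (a * b)%:R, f2 ^+ 2 = (a * c)%:R, f3 ^+ 2 = (b * c)%:R
    & [/\ f1 * f2 = a%:R * f3, f1 * f3 = b%:R * f2 & f2 * f3 = c%:R * f1]].

Lemma rational_combM x y z w x' y' z' w' : frame_relations ->
  rational_comb x y z w * rational_comb x' y' z' w' =
  rational_comb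
    (x * x' + (a * b)%:R * (y * y') + (a * c)%:R * (z * z') + (b * c)%:R * (w * w'))
    (x * y' + y * x' + c%:R * (z * w' + w * z'))
    (x * z' + z * x' + b%:R * (y * w' + w * y'))
    (x * w' + w * x' + a%:R * (y * z' + z * y')).
Proof.
rewrite /rational_comb => -[E11 E22 E33 [E12 E13 E23]].
rewrite !(rmorphD, rmorphM i, rmorph_nat) -E11 -E22 -E33.
set u := _ * _; set v := _ + _.
(* The mixed products are unknown to [ring]; they enter as multiples of the three relations, which
   are then set to 0. *)
have -> : u = v + (i y * i z' + i z * i y') * (f1 * f2 - a%:R * f3)
  + (i y * i w' + i w * i y') * (f1 * f3 - b%:R * f2)
  + (i z * i w' + i w * i z') * (f2 * f3 - c%:R * f1) by rewrite /u /v; ring.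
by rewrite E12 E13 E23 !subrr !mulr0 !addr0.
Qed.

Lemma rational_combB x y z w x' y' z' w' :
  rational_comb x y z w - rational_comb x' y' z' w' =
  rational_comb (x - x') (y - y') (z - z') (w - w').
Proof. by rewrite /rational_comb !rmorphB /=; ring. Qed.

End RationalSpan.

Section FrameAlgebra.

Variables (K : fieldExtType rat) (a b c : nat) (e1 e2 e3 : K).
Hypothesis F : frame a b c e1 e2 e3.
Implicit Types x y z w : rat.

Lemma lincombE x y z w :
  lincomb e1 e2 e3 x y z w = rational_comb (in_alg K) e1 e2 e3 x y z w.
Proof. by rewrite /lincomb /rational_comb /= !mulr_algl. Qed.

Lemma frame_relationsK : frame_relations a b c e1 e2 e3.
Proof. by case: F. Qed.

Lemma lincombM x y z w x' y' z' w' :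
  lincomb e1 e2 e3 x y z w * lincomb e1 e2 e3 x' y' z' w' =
  lincomb e1 e2 e3
    (x * x' + (a * b)%:R * (y * y') + (a * c)%:R * (z * z') + (b * c)%:R * (w * w'))
    (x * y' + y * x' + c%:R * (z * w' + w * z'))
    (x * z' + z * x' + b%:R * (y * w' + w * y'))
    (x * w' + w * x' + a%:R * (y * z' + z * y')).
Proof. by rewrite !lincombE (rational_combM _ _ _ _ _ _ _ _ _ frame_relationsK). Qed.

Lemma lincombB x y z w x' y' z' w' :
  lincomb e1 e2 e3 x y z w - lincomb e1 e2 e3 x' y' z' w' =
  lincomb e1 e2 e3 (x - x') (y - y') (z - z') (w - w').
Proof. by rewrite !lincombE rational_combB. Qed.

Lemma frame_gt0 : [/\ (0 < a)%N, (0 < b)%N & (0 < c)%N].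
Proof.
have := squarefree_gt0 (frame_sqf12 F); have := squarefree_gt0 (frame_sqf13 F).
by rewrite !muln_gt0 => /andP[-> ->] /andP[_ ->].
Qed.

Lemma frame_gt1 : (1 < a * b)%N.
Proof.
case: frame_gt0 => a0 b0 _; have := frame_neq12 F.
by case: a a0 => [|[|n]]; case: b b0 => [|[|m]] //; rewrite ?mul1n ?mulnS //.
Qed.

Lemma lincomb2_eq0 x y : in_alg K x + in_alg K y * e1 = 0 -> x = 0 /\ y = 0.
Proof.
move=> E.
have E2 : in_alg K (x ^+ 2) = in_alg K ((a * b)%:R * y ^+ 2).
  have -> : in_alg K (x ^+ 2) = in_alg K x ^+ 2 by rewrite rmorphXn.
  have -> : in_alg K ((a * b)%:R * y ^+ 2) = e1 ^+ 2 * in_alg K y ^+ 2.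
    by rewrite rmorphM rmorphXn rmorph_nat (frame_e11 F).
  by move/eqP: E; rewrite addr_eq0 => /eqP ->; rewrite sqrrN exprMn mulrC.
have y0 : y = 0.
  exact: squarefree_irrational (frame_sqf12 F) frame_gt1 (fmorph_inj _ E2).
split=> //; move: E; rewrite y0 rmorph0 mul0r addr0 => /eqP.
by rewrite fmorph_eq0 => /eqP.
Qed.

(** A vanishing element has vanishing relative norm to the field of e1; this is the e1 coordinate of
    that norm. *)
Lemma lincomb_eq0_step x y z w :
  lincomb e1 e2 e3 x y z w = 0 -> x * y = c%:R * (z * w).
Proof.
move=> E; have := congr1 ( *%R^~ (lincomb e1 e2 e3 x y (- z) (- w))) E.
rewrite lincombM mul0r => E'.
have /lincomb2_eq0[_] : in_alg K (x * x + (a * b)%:R * (y * y)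
    - (a * c)%:R * (z * z) - (b * c)%:R * (w * w)) +
    in_alg K (x * y + y * x - c%:R * (z * w + w * z)) * e1 = 0.
  rewrite -E' lincombE /rational_comb.
  have -> : x * - z + z * x + b%:R * (y * - w + w * y) = 0 by ring.
  have -> : x * - w + w * x + a%:R * (y * - z + z * y) = 0 by ring.
  rewrite rmorph0 !mul0r !addr0; congr (in_alg K _ + in_alg K _ * _); ring.
lra.
Qed.

End FrameAlgebra.

(** Linear independence follows from the preceding relation, read in the three permuted frames, and
    the irrationality of the three square roots. *)
Lemma lincomb_eq0 (K : fieldExtType rat) a b c (e1 e2 e3 : K) x y z w :
  frame a b c e1 e2 e3 -> lincomb e1 e2 e3 x y z w = 0 ->
  [/\ x = 0, y = 0, z = 0 & w = 0].
Proof.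
move=> F E.
have F2 := frame_swap23 F; have F3 := frame_swap23 (frame_swap12 F).
have xy := lincomb_eq0_step F E.
have xz : x * z = b%:R * (y * w).
  by apply: (lincomb_eq0_step F2); rewrite -E !lincombE /rational_comb; ring.
have xw : x * w = a%:R * (y * z).
  by apply: (lincomb_eq0_step F3); rewrite -E !lincombE /rational_comb; ring.
have irr1 := squarefree_irrational (frame_sqf12 F) (frame_gt1 F).
have irr2 := squarefree_irrational (frame_sqf12 F2) (frame_gt1 F2).
have irr3 := squarefree_irrational (frame_sqf12 F3) (frame_gt1 F3).
have n0 n (e : K) : e ^+ 2 = n%:R -> (1 < n)%N -> e != 0.
  move=> eE n1; apply/eqP => e0; move/eqP: eE.
  rewrite e0 expr0n /= eq_sym => /eqP n0.
  by have := natK_neq0 K n.-1; rewrite prednK ?(ltnW n1) // n0 eqxx.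
have x0 : x = 0.
  apply/eqP/negPn/negP => x0.
  have cancel m (v u : rat) : (forall X W : rat, X ^+ 2 = m%:R * W ^+ 2 -> W = 0) ->
      x ^+ 2 * u = m%:R * v ^+ 2 * u -> u = 0.
    move=> irr xE; apply/eqP/negPn/negP => u0.
    have xE' := mulIf u0 xE; have v0 := irr _ _ xE'.
    by move: xE'; rewrite v0 expr0n /= mulr0 => /eqP; rewrite sqrf_eq0; apply/negP.
  (* The product of two relations is x^2 y z = b c w^2 y z, and b c is not a rational square. *)
  have yz : y * z = 0.
    apply: (cancel _ w _ irr3).
    have -> : x ^+ 2 * (y * z) = (x * y) * (x * z) by ring.
    by rewrite xy xz natrM; ring.
  have yw : y * w = 0.
    apply: (cancel _ z _ irr2).
    have -> : x ^+ 2 * (y * w) = (x * y) * (x * w) by ring.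
    by rewrite xy xw natrM; ring.
  have zw : z * w = 0.
    apply: (cancel _ y _ irr1).
    have -> : x ^+ 2 * (z * w) = (x * z) * (x * w) by ring.
    by rewrite xz xw natrM; ring.
  move: xy xz xw E; rewrite yz yw zw !mulr0.
  move=> /eqP + /eqP + /eqP; rewrite !mulf_eq0 (negbTE x0) /=.
  move=> /eqP -> /eqP -> /eqP ->; rewrite lincombE /rational_comb !rmorph0 !mul0r !addr0.
  by move/eqP; rewrite fmorph_eq0; apply/negP.
subst x; move: xy xz xw E; rewrite !mul0r => /esym/eqP + /esym/eqP + /esym/eqP.
case: (frame_gt0 F) => a0 b0 c0.
rewrite !mulf_eq0 !pnatr_eq0 !(gtn_eqF a0, gtn_eqF b0, gtn_eqF c0) /= lincombE.
have e10 := n0 _ _ (frame_e11 F) (frame_gt1 F).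
have e20 := n0 _ _ (frame_e22 F) (frame_gt1 F2).
have e30 := n0 _ _ (frame_e33 F) (frame_gt1 F3).
case: (eqVneq y 0) => [->|y0]; case: (eqVneq z 0) => [->|z0];
  case: (eqVneq w 0) => [->|w0] //= _ _ _;
  rewrite /rational_comb !rmorph0 ?mul0r ?addr0 ?add0r;
  move/eqP; rewrite ?mulf_eq0 ?fmorph_eq0 ?(negbTE y0) ?(negbTE z0) ?(negbTE w0);
  by rewrite ?(negbTE e10) ?(negbTE e20) ?(negbTE e30).
Qed.

Lemma sqrt_mul_common (R : rcfType) (a b c : nat) :
  Num.sqrt (a * b)%:R * Num.sqrt (a * c)%:R = a%:R * Num.sqrt (b * c)%:R :> R.
Proof.
rewrite -sqrtrM ?ler0n // -natrM.
have -> : (a * b * (a * c) = a ^ 2 * (b * c))%N by lia.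
by rewrite natrM sqrtrM ?ler0n // natrX sqrtr_sqr ger0_norm ?ler0n.
Qed.

(** * Real embeddings, trace and norm *)

Section FrameEmbeddings.

Variables (R : realType) (K : fieldExtType rat).

(** Copying coordinates is well defined by linear independence and multiplicative because both
    triples obey the same table. *)
Lemma frame_embedding a b c (e1 e2 e3 : K) (f1 f2 f3 : R) :
  frame a b c e1 e2 e3 -> frame_relations a b c f1 f2 f3 ->
  exists sigma : {rmorphism K -> R}, forall x y z w,
    sigma (lincomb e1 e2 e3 x y z w) = rational_comb ratr f1 f2 f3 x y z w.
Proof.
move=> F rel.
have [v|cd cdE] := @choice K (rat * rat * (rat * rat))
    (fun v t => v = lincomb e1 e2 e3 t.1.1 t.1.2 t.2.1 t.2.2).
  by have [x [y [z [w ->]]]] := frame_span F v; exists (x, y, (z, w)).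
pose phi v := rational_comb (ratr : rat -> R) f1 f2 f3
  (cd v).1.1 (cd v).1.2 (cd v).2.1 (cd v).2.2.
have phiE x y z w :
    phi (lincomb e1 e2 e3 x y z w) = rational_comb ratr f1 f2 f3 x y z w.
  have := cdE (lincomb e1 e2 e3 x y z w); rewrite /phi.
  case: (cd _) => [[x' y'] [z' w']] /= /eqP; rewrite -subr_eq0 lincombB.
  move/eqP/(lincomb_eq0 F) => [/eqP + /eqP + /eqP + /eqP].
  by rewrite !subr_eq0 => /eqP-> /eqP-> /eqP-> /eqP->.
have phiB : GRing.zmod_morphism phi.
  move=> u v; have [x [y [z [w ->]]]] := frame_span F u.
  have [x' [y' [z' [w' ->]]]] := frame_span F v.
  by rewrite lincombB !phiE rational_combB.
have phiM : GRing.monoid_morphism phi.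
  split=> [|u v].
    have -> : (1 : K) = lincomb e1 e2 e3 1 0 0 0.
      by rewrite lincombE /rational_comb !rmorph0 rmorph1 !mul0r !addr0.
    by rewrite phiE /rational_comb !rmorph0 rmorph1 !mul0r !addr0.
  have [x [y [z [w ->]]]] := frame_span F u.
  have [x' [y' [z' [w' ->]]]] := frame_span F v.
  by rewrite (lincombM F) !phiE (rational_combM _ _ _ _ _ _ _ _ _ rel).
pose phi1 : {additive K -> R} := HB.pack phi (GRing.isZmodMorphism.Build _ _ phi phiB).
pose phi2 : {rmorphism K -> R} := HB.pack phi phi1 (GRing.isMonoidMorphism.Build _ _ phi phiM).
by exists phi2.
Qed.

(** The booleans choose the signs of e1 and e2; that of e3 is their product. *)
Definition real_comb (a b c : nat) (i : bool * bool) (x y z w : rat) : R :=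
  rational_comb ratr ((-1) ^+ i.1 * Num.sqrt (a * b)%:R)
    ((-1) ^+ i.2 * Num.sqrt (a * c)%:R)
    ((-1) ^+ i.1 * (-1) ^+ i.2 * Num.sqrt (b * c)%:R) x y z w.

Lemma real_frame_relations (a b c : nat) (i : bool * bool) :
  frame_relations a b c ((-1) ^+ i.1 * Num.sqrt (a * b)%:R : R)
    ((-1) ^+ i.2 * Num.sqrt (a * c)%:R)
    ((-1) ^+ i.1 * (-1) ^+ i.2 * Num.sqrt (b * c)%:R).
Proof.
have PQ := sqrt_mul_common R a b c.
have PS := sqrt_mul_common R b a c; rewrite mulnC in PS.
have QS := sqrt_mul_common R c a b; rewrite mulnC [(c * b)%N]mulnC in QS.
have sq0 n : Num.sqrt (n%:R : R) ^+ 2 = n%:R by rewrite sqr_sqrtr ?ler0n.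
case: i => [[] []] /=; rewrite ?expr1 ?expr0 ?mul1r ?mulN1r ?opprK ?sqrrN ?mul1r;
  split; rewrite ?sqrrN ?sq0 //; split;
  by rewrite ?mulrN ?mulNr ?opprK ?PQ ?PS ?QS.
Qed.

Variables (a b c : nat) (e1 e2 e3 : K).
Hypothesis F : frame a b c e1 e2 e3.
Implicit Types x y z w : rat.

Local Notation lc := (lincomb e1 e2 e3).
Local Notation P := (Num.sqrt (a * b)%:R : R).
Local Notation Q := (Num.sqrt (a * c)%:R : R).
Local Notation S := (Num.sqrt (b * c)%:R : R).

Lemma real_combE x y z w :
  [/\ real_comb a b c (false, false) x y z w
         = ratr x + ratr y * P + (ratr z * Q + ratr w * S),
      real_comb a b c (false, true) x y z w
         = ratr x + ratr y * P - (ratr z * Q + ratr w * S),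
      real_comb a b c (true, false) x y z w
         = ratr x - ratr y * P + (ratr z * Q - ratr w * S)
    & real_comb a b c (true, true) x y z w
         = ratr x - ratr y * P - (ratr z * Q - ratr w * S)].
Proof.
by rewrite /real_comb /rational_comb /= expr0 expr1; split; ring.
Qed.

Lemma sum_bool2 (f : bool * bool -> R) :
  \sum_i f i = f (false, false) + f (false, true) + (f (true, false) + f (true, true)).
Proof.
rewrite (eq_bigr (fun p => f (p.1, p.2))) => [|[]//].
rewrite -(pair_bigA _ (fun i j => f (i, j))) /= !big_bool /=; ring.
Qed.

Lemma prod_bool2 (f : bool * bool -> R) :
  \prod_i f i = f (false, false) * f (false, true) * (f (true, false) * f (true, true)).
Proof.
rewrite (eq_bigr (fun p => f (p.1, p.2))) => [|[]//].
rewrite -(pair_bigA _ (fun i j => f (i, j))) /= !big_bool /=; ring.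
Qed.

(** With [relnorm_irr], the coordinates on 1 and e1 of the relative norm to the field of e1, where
    conjugation changes the signs of e2 and e3. *)
Definition relnorm_rat x y z w : rat :=
  x ^+ 2 + (a * b)%:R * y ^+ 2 - (a * c)%:R * z ^+ 2 - (b * c)%:R * w ^+ 2.

Definition relnorm_irr x y z w : rat := 2%:R * (x * y - c%:R * (z * w)).

Definition absnorm x y z w : rat :=
  relnorm_rat x y z w ^+ 2 - (a * b)%:R * relnorm_irr x y z w ^+ 2.

Lemma real_comb_relnorm x y z w :
  real_comb a b c (false, false) x y z w * real_comb a b c (false, true) x y z w
    = ratr (relnorm_rat x y z w) + ratr (relnorm_irr x y z w) * P /\
  real_comb a b c (true, false) x y z w * real_comb a b c (true, true) x y z w
    = ratr (relnorm_rat x y z w) - ratr (relnorm_irr x y z w) * P.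
Proof.
case: (real_combE x y z w) => -> -> -> ->.
rewrite /relnorm_rat /relnorm_irr.
rewrite !(rmorphB, rmorphD, rmorphXn, rmorphM (ratr : rat -> R), rmorph_nat).
have sq0 n : Num.sqrt (n%:R : R) ^+ 2 = n%:R by rewrite sqr_sqrtr ?ler0n.
have QS := sqrt_mul_common R c a b; rewrite mulnC [(c * b)%N]mulnC in QS.
move: (sq0 (a * b)%N) (sq0 (a * c)%N) (sq0 (b * c)%N) QS.
move: P Q S => P1 Q1 S1 <- <- <- QS.
have E : 2%:R * (ratr x * ratr y - c%:R * (ratr z * ratr w)) * P1 =
  2%:R * (ratr x * ratr y * P1 - ratr z * ratr w * (c%:R * P1)) by ring.
by rewrite {}E -QS; split; ring.
Qed.

Lemma prod_real_comb x y z w :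
  \prod_i real_comb a b c i x y z w = ratr (absnorm x y z w).
Proof.
rewrite prod_bool2; case: (real_comb_relnorm x y z w) => -> ->.
rewrite /absnorm; move: (relnorm_rat x y z w) (relnorm_irr x y z w) => t u.
have -> : ratr (t ^+ 2 - (a * b)%:R * u ^+ 2) =
    ratr t ^+ 2 - (a * b)%:R * ratr u ^+ 2 :> R.
  by rewrite rmorphB [X in _ - X]rmorphM !rmorphXn /= ratr_nat.
by move: (sqr_sqrtr (ler0n R (a * b))); move: P => P1 <-; ring.
Qed.

Lemma frame_full_embeddings :
  exists s : bool * bool -> {rmorphism K -> R}, full_embeddings s /\
    forall i x y z w, s i (lc x y z w) = real_comb a b c i x y z w.
Proof.
have [i|s sE] := @choice (bool * bool) {rmorphism K -> R}
    (fun i sigma => forall x y z w, sigma (lc x y z w) = real_comb a b c i x y z w).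
  exact: frame_embedding F (real_frame_relations a b c i).
exists s; split=> //; split=> [v vO|v vO|sigma].
- suff [r rE] : exists r : rat, \sum_i s i v = ratr r.
    have [|n nE] := @ratr_integral R r; last by exists n; rewrite rE nE ratr_int.
    rewrite -rE sum_bool2.
    by do !apply: integral_add; apply: rmorph_in_OK.
  have [x [y [z [w ->]]]] := frame_span F v; exists (4%:R * x).
  rewrite sum_bool2 !sE; case: (real_combE x y z w) => -> -> -> ->.
  have -> : ratr (4%:R * x) = 4%:R * ratr x :> R by rewrite rmorphM /= ratr_nat.
  by ring.
- suff [r rE] : exists r : rat, \prod_i s i v = ratr r.
    have [|n nE] := @ratr_integral R r; last by exists n; rewrite rE nE ratr_int.
    rewrite -rE prod_bool2.
    by do !apply: integral_mul; apply: rmorph_in_OK.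
  have [x [y [z [w ->]]]] := frame_span F v; exists (absnorm x y z w).
  by rewrite -prod_real_comb; apply: eq_bigr => i _; rewrite sE.
(* An embedding is known from the signs it gives to e1 and e2: the image of e3 follows from e1 e2 =
   a e3 with a nonzero. *)
have [sgn sgnE] : exists sgn : bool * bool,
    sigma e1 = (-1) ^+ sgn.1 * P /\ sigma e2 = (-1) ^+ sgn.2 * Q.
  have sg (e : K) n : e ^+ 2 = n%:R -> exists i : bool, sigma e = (-1) ^+ i * Num.sqrt n%:R.
    move=> eE; have : sigma e ^+ 2 == Num.sqrt n%:R ^+ 2.
      by rewrite -rmorphXn eE rmorph_nat sqr_sqrtr ?ler0n.
    rewrite eqf_sqr => /orP[] /eqP ->; [exists false | exists true].
      by rewrite expr0 mul1r.
    by rewrite expr1 mulN1r.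
  have [i iE] := sg _ _ (frame_e11 F); have [j jE] := sg _ _ (frame_e22 F).
  by exists (i, j).
exists sgn => v; have [x [y [z [w ->]]]] := frame_span F v.
have a0 : (a%:R : R) != 0 by case: (frame_gt0 F) => + _ _; rewrite pnatr_eq0 -lt0n.
have e3E : sigma e3 = (-1) ^+ sgn.1 * (-1) ^+ sgn.2 * S.
  apply: (mulfI a0); have [_ _ _ [<- _ _]] := real_frame_relations a b c sgn.
  by rewrite -(rmorph_nat sigma) -rmorphM -(frame_e12 F) rmorphM; case: sgnE => -> ->.
rewrite sE /real_comb /rational_comb /lincomb !rmorphD /=.
have sc (t : rat) (u : K) : sigma (t *: u) = ratr t * sigma u.
  rewrite -mulr_algl rmorphM; congr (_ * _).
  exact: (fmorph_eq_rat (sigma \o in_alg K) t).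
by rewrite !sc rmorph1 mulr1; case: sgnE => -> ->; rewrite e3E.
Qed.

End FrameEmbeddings.

(** * Integers of K in coordinates with denominator 4 *)

Lemma sqr_mod4 (X : int) : exists t : int,
  exists2 i : int, X ^+ 2 = 4%:Z * t + i & (i = 0 /\ exists h : int, X = 2%:Z * h) \/
    (i = 1 /\ exists h : int, X = 2%:Z * h + 1).
Proof.
have [[h hE]|[h hE]] : (exists h : int, X = 2%:Z * h) \/ (exists h : int, X = 2%:Z * h + 1).
- by case: (boolP (2 %| X)%Z) => H; [left; exists (X %/ 2)%Z | right; exists (X %/ 2)%Z]; lia.
- by exists (h ^+ 2), 0; [rewrite hE; ring | left; split=> //; exists h].
- by exists (h ^+ 2 + h), 1; [rewrite hE; ring | right; split=> //; exists h].
Qed.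

Lemma squarefree_mod4 (n : nat) : squarefree n -> (n %% 4 <> 0)%N.
Proof. by move=> sq n4; have := sq 2%N; rewrite /dvdn n4 => /(_ isT). Qed.

(* The relative trace of an integer of K with coordinates X/4 on 1 and Y/4 on
   sqrt n is (X + Y sqrt n)/2, whose norm (X^2 - n Y^2)/4 is an integer. *)
Definition norm_mod4 (n : nat) (X Y : int) : Prop :=
  exists k : int, X ^+ 2 - n%:Z * Y ^+ 2 = 4%:Z * k.

(** Reduction modulo 4, where squares are 0 or 1 and a square-free n is not 0. *)
Lemma norm_mod4_even n X Y : squarefree n -> norm_mod4 n X Y ->
  (n %% 4 <> 1)%N \/ (exists h : int, X = 2%:Z * h) ->
  (exists h : int, X = 2%:Z * h) /\ (exists h : int, Y = 2%:Z * h).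
Proof.
move=> sq [k E]; have n0 := squarefree_mod4 sq; have nE := divn_eq n 4.
have [s [i sE sP]] := sqr_mod4 X; have [t [j tE tP]] := sqr_mod4 Y.
have nZ : n%:Z = (n %/ 4)%N%:Z * 4%:Z + (n %% 4)%N%:Z by lia.
have rE : (n %% 4 = 1 \/ n %% 4 = 2 \/ n %% 4 = 3)%N by lia.
rewrite sE tE nZ in E => H; move: (n %/ 4)%N E {nE nZ} => u E.
have iE : i = 0.
  case: sP => -[iE [h hX]] //; case: H => [r1|[h' hX']]; last by exfalso; lia.
  by case: tP => -[jE _]; subst i j; case: rE => [|[]] rE; rewrite rE in E r1; lia.
have jE : j = 0.
  by case: tP => -[jE _] //; subst i j; case: rE => [|[]] rE; rewrite rE in E; lia.
by case: sP tP => -[iE' hX] [[jE' hY]|[jE' hY]] //; subst.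
Qed.

Lemma norm_mod4_parity n X Y : (n %% 4 = 1)%N -> norm_mod4 n X Y ->
  exists h : int, X - Y = 2%:Z * h.
Proof.
move=> n1 [k E]; have nE := divn_eq n 4.
have [s [i sE sP]] := sqr_mod4 X; have [t [j tE tP]] := sqr_mod4 Y.
have nZ : n%:Z = (n %/ 4)%N%:Z * 4%:Z + 1 by lia.
rewrite sE tE nZ in E; move: (n %/ 4)%N E {nE nZ} => u E.
case: sP => -[iE [h hX]]; case: tP => -[jE [h' hY]]; subst i j.
- by exists (h - h'); lia.
- by exfalso; lia.
- by exfalso; lia.
- by exists (h - h'); lia.
Qed.

Section QuarterCoordinates.

Variables (R : realType) (K : fieldExtType rat).

(** All integers of K have this shape, so decompositions can be studied on integer numerators. *)
Definition quarter_comb (e1 e2 e3 : K) (X Y Z W : int) : K :=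
  lincomb e1 e2 e3 (X%:~R / 4%:R) (Y%:~R / 4%:R) (Z%:~R / 4%:R) (W%:~R / 4%:R).

Variables (a b c : nat) (e1 e2 e3 : K).
Hypothesis F : frame a b c e1 e2 e3.
Implicit Types X Y Z W : int.

Local Notation P := (Num.sqrt (a * b)%:R : R).
Local Notation Q := (Num.sqrt (a * c)%:R : R).
Local Notation S := (Num.sqrt (b * c)%:R : R).

Lemma lincomb_inj x y z w x' y' z' w' :
  lincomb e1 e2 e3 x y z w = lincomb e1 e2 e3 x' y' z' w' ->
  [/\ x = x', y = y', z = z' & w = w'].
Proof.
move/eqP; rewrite -subr_eq0 lincombB => /eqP/(lincomb_eq0 F)[].
by move=> /eqP + /eqP + /eqP + /eqP; rewrite !subr_eq0; do 4 move=> /eqP ->.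
Qed.

Lemma quarter_combD X Y Z W X' Y' Z' W' :
  quarter_comb e1 e2 e3 X Y Z W + quarter_comb e1 e2 e3 X' Y' Z' W' =
  quarter_comb e1 e2 e3 (X + X') (Y + Y') (Z + Z') (W + W').
Proof.
rewrite /quarter_comb /lincomb !intrD !mulrDl !scalerDl.
by rewrite addrACA; congr (_ + _); rewrite addrACA; congr (_ + _); rewrite addrACA.
Qed.

Lemma quarter_comb_inj X Y Z W X' Y' Z' W' :
  quarter_comb e1 e2 e3 X Y Z W = quarter_comb e1 e2 e3 X' Y' Z' W' ->
  [/\ X = X', Y = Y', Z = Z' & W = W'].
Proof.
have inj4 (t u : int) : t%:~R / 4%:R = u%:~R / 4%:R :> rat -> t = u.
  by move=> E; apply: (@intr_inj rat); lra.
by case/lincomb_inj; do 4 move=> /inj4 ->.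
Qed.

(** Positivity of the four real conjugates, cleared of the denominator 4. *)
Definition quarter_pos X Y Z W : Prop :=
  [/\ 0 < X%:~R + Y%:~R * P + (Z%:~R * Q + W%:~R * S),
      0 < X%:~R + Y%:~R * P - (Z%:~R * Q + W%:~R * S),
      0 < X%:~R - Y%:~R * P + (Z%:~R * Q - W%:~R * S)
    & 0 < X%:~R - Y%:~R * P - (Z%:~R * Q - W%:~R * S)].

Lemma ratr_quarter X : ratr (X%:~R / 4%:R) = X%:~R / 4%:R :> R.
Proof. by rewrite fmorph_div /= ratr_int ratr_nat. Qed.

Lemma quarter_comb_pos X Y Z W :
  totally_positive R (quarter_comb e1 e2 e3 X Y Z W) <-> quarter_pos X Y Z W.
Proof.
have [s [sP sE]] := frame_full_embeddings R F.
have [E1 E2 E3 E4] := real_combE R a b c (X%:~R / 4%:R) (Y%:~R / 4%:R) (Z%:~R / 4%:R) (W%:~R / 4%:R).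
rewrite !ratr_quarter in E1 E2 E3 E4; split=> [p|[p1 p2 p3 p4]].
  have := p (s (false, false)); have := p (s (false, true)).
  have := p (s (true, false)); have := p (s (true, true)).
  rewrite /quarter_comb !sE E1 E2 E3 E4 /quarter_pos.
  by move: P Q S => P1 Q1 S1 *; split; lra.
apply: (full_embeddings_pos sP) => -[[] []]; rewrite /quarter_comb sE ?E1 ?E2 ?E3 ?E4.
all: move: P Q S p1 p2 p3 p4 {E1 E2 E3 E4} => P1 Q1 S1 *; lra.
Qed.

(** The trace 4 x is an integer X, and the relative trace 2 (x + y e1) has an integral norm k. Hence
    ab (4 y)^2 = X^2 - 4 k, and 4 y is an integer because ab is square-free. *)
Lemma in_OK_lincomb x y z w : in_OK (lincomb e1 e2 e3 x y z w) ->
  exists X Y, [/\ x = X%:~R / 4%:R, y = Y%:~R / 4%:R & norm_mod4 (a * b) X Y].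
Proof.
have [s [_ sE]] := frame_full_embeddings R F => vO.
have O i : integralOver (intr : int -> R) (real_comb R a b c i x y z w).
  by rewrite -sE; apply: rmorph_in_OK.
have [E1 E2 E3 E4] := real_combE R a b c x y z w.
have [X XE] : exists X : int, 4%:R * x = X%:~R.
  apply: (@ratr_integral R).
  have -> : ratr (4%:R * x) = real_comb R a b c (false, false) x y z w
    + real_comb R a b c (false, true) x y z w
    + (real_comb R a b c (true, false) x y z w + real_comb R a b c (true, true) x y z w).
    by rewrite E1 E2 E3 E4 rmorphM /= ratr_nat; ring.
  by apply: integral_add; apply: integral_add.
have [k kE] : exists k : int, 4%:R * (x ^+ 2 - (a * b)%:R * y ^+ 2) = k%:~R.
  apply: (@ratr_integral R).
  have -> : ratr (4%:R * (x ^+ 2 - (a * b)%:R * y ^+ 2)) =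
    (real_comb R a b c (false, false) x y z w + real_comb R a b c (false, true) x y z w)
    * (real_comb R a b c (true, false) x y z w + real_comb R a b c (true, true) x y z w).
    have -> : ratr (4%:R * (x ^+ 2 - (a * b)%:R * y ^+ 2)) =
        4%:R * (ratr x ^+ 2 - (a * b)%:R * ratr y ^+ 2) :> R.
      rewrite rmorphM /= ratr_nat rmorphB [X in _ - X]rmorphM /= !rmorphXn /=.
      by rewrite ratr_nat.
    rewrite E1 E2 E3 E4; move: (sqr_sqrtr (ler0n R (a * b))).
    by move: P Q S => P1 Q1 S1 <-; ring.
  by apply: integral_mul; apply: integral_add.
have [|Y YE] := @squarefree_rat (a * b) (4%:R * y) (X ^+ 2 - 4%:Z * k) (frame_sqf12 F).
  by rewrite intrB intrM rmorphXn /= -kE -XE -pmulrn; ring.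
exists X, Y; split; [by rewrite -XE; field | by rewrite -YE; field |].
exists k; apply: (@intr_inj rat).
by rewrite intrB !(rmorphXn, intrM) /= -XE -YE -kE -!pmulrn; ring.
Qed.

Lemma absnorm_int x y z w : in_OK (lincomb e1 e2 e3 x y z w) ->
  exists n : int, absnorm a b c x y z w = n%:~R.
Proof.
have [s [_ sE]] := frame_full_embeddings R F => vO; apply: (@ratr_integral R).
have O i : integralOver (intr : int -> R) (real_comb R a b c i x y z w).
  by rewrite -sE; apply: rmorph_in_OK.
rewrite -prod_real_comb prod_bool2.
by apply: integral_mul; apply: integral_mul.
Qed.

End QuarterCoordinates.

Section FrameIntegers.

Variables (R : realType) (K : fieldExtType rat).

Lemma lincomb_swap23 (e1 e2 e3 : K) x y z w :
  lincomb e1 e2 e3 x y z w = lincomb e2 e1 e3 x z y w.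
Proof. by rewrite /lincomb -!addrA; congr (_ + _); rewrite addrCA. Qed.

Lemma lincomb_swap12 (e1 e2 e3 : K) x y z w :
  lincomb e1 e2 e3 x y z w = lincomb e1 e3 e2 x y w z.
Proof. by rewrite /lincomb -!addrA [_ *: e2 + _]addrC. Qed.

Variables (a b c : nat) (e1 e2 e3 : K).
Hypothesis F : frame a b c e1 e2 e3.
Implicit Types X Y Z W : int.

Local Notation P := (Num.sqrt (a * b)%:R : R).
Local Notation Q := (Num.sqrt (a * c)%:R : R).
Local Notation S := (Num.sqrt (b * c)%:R : R).

Lemma in_OK_quarter v : in_OK v -> exists X Y Z W,
  [/\ v = quarter_comb e1 e2 e3 X Y Z W, norm_mod4 (a * b) X Y,
      norm_mod4 (a * c) X Z & norm_mod4 (b * c) X W].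
Proof.
have F2 := frame_swap23 F; have F3 := frame_swap23 (frame_swap12 F).
have [x [y [z [w ->]]]] := frame_span F v => vO.
have [X [Y [E1 -> mY]]] := in_OK_lincomb R F vO.
have := vO; rewrite lincomb_swap23 => /(in_OK_lincomb R F2)[X2 [Z [E2 -> mZ]]].
have := vO; rewrite lincomb_swap12 lincomb_swap23.
move=> /(in_OK_lincomb R F3)[X3 [W [E3 -> mW]]].
have inj4 (t u : int) : t%:~R / 4%:R = u%:~R / 4%:R :> rat -> t = u.
  by move=> E; apply: (@intr_inj rat); lra.
rewrite E1 in E2 E3 *.
exists X, Y, Z, W; split=> //; first by rewrite (inj4 _ _ E2).
by rewrite (inj4 _ _ E3).
Qed.

Lemma sqr_sqrtn (n : nat) : Num.sqrt n%:R ^+ 2 = n%:R :> R.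
Proof. by rewrite sqr_sqrtr ?ler0n. Qed.

Lemma int_sqrt_lt X Z (n : nat) : 0 < X -> `|Z%:~R * Num.sqrt n%:R| < X%:~R :> R ->
  Z ^+ 2 * n%:Z < X ^+ 2.
Proof.
move=> X0; rewrite -ltr_sqr ?nnegrE ?normr_ge0 ?ler0z ?ltW // real_normK ?num_real //.
rewrite exprMn sqr_sqrtn -!rmorphXn /= -(ltr_int R) intrM.
by [].
Qed.

Lemma quarter_pos_bounds X Y Z W : quarter_pos R a b c X Y Z W ->
  [/\ 0 < X, Y ^+ 2 * (a * b)%N%:Z < X ^+ 2, Z ^+ 2 * (a * c)%N%:Z < X ^+ 2
    & W ^+ 2 * (b * c)%N%:Z < X ^+ 2].
Proof.
rewrite /quarter_pos => -[p1 p2 p3 p4].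
have X0 : 0 < X by rewrite -(ltr0z R); move: P Q S p1 p2 p3 p4 => P1 Q1 S1 *; lra.
by split=> //; apply: int_sqrt_lt => //; rewrite ltr_norml; apply/andP;
  move: P Q S p1 p2 p3 p4 => P1 Q1 S1 *; split; lra.
Qed.

Lemma pair_product_bound (u A v B : R) :
  0 < u + A -> 0 < u - A -> 0 < v + B -> 0 < v - B ->
  256%:R <= (u + A) * (u - A) * ((v + B) * (v - B)) -> 16%:R <= u * v.
Proof.
move=> uA uA' vB vB' le; rewrite leNgt; apply/negP => lt.
have u0 : 0 < u by lra.
have v0 : 0 < v by lra.
have : (u + A) * (u - A) * ((v + B) * (v - B)) <= u ^+ 2 * v ^+ 2.
  apply: ler_pM.
  - exact: mulr_ge0 (ltW uA) (ltW uA').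
  - exact: mulr_ge0 (ltW vB) (ltW vB').
  - by rewrite -subr_ge0; have := sqr_ge0 A; lra.
  - by rewrite -subr_ge0; have := sqr_ge0 B; lra.
have : (u * v) ^+ 2 < 16%:R ^+ 2.
  by rewrite ltr_sqr ?nnegrE ?ler0n //; apply/ltW/mulr_gt0.
rewrite exprMn; lra.
Qed.

(** The norm is at least 1, and a product of two relative conjugates is at most the square of their
    mean; so the relative trace (X + Y sqrt(ab))/2 has norm at least 4. *)
Lemma quarter_norm_bound X Y Z W :
  in_OKplus R (quarter_comb e1 e2 e3 X Y Z W) ->
  16%:Z <= X ^+ 2 - (a * b)%N%:Z * Y ^+ 2.
Proof.
move=> vO; have [s [sP sE]] := frame_full_embeddings R F.
have := norm_ge1 sP vO; case: vO => _ /(quarter_comb_pos R F).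
rewrite /quarter_pos => -[p1 p2 p3 p4].
have [E1 E2 E3 E4] := real_combE R a b c (X%:~R / 4%:R) (Y%:~R / 4%:R)
  (Z%:~R / 4%:R) (W%:~R / 4%:R).
rewrite prod_bool2 /quarter_comb !sE E1 E2 E3 E4 !ratr_quarter => N.
have /(pair_product_bound p1 p2 p3 p4) :
    256%:R <= (X%:~R + Y%:~R * P + (Z%:~R * Q + W%:~R * S)) *
      (X%:~R + Y%:~R * P - (Z%:~R * Q + W%:~R * S)) *
      ((X%:~R - Y%:~R * P + (Z%:~R * Q - W%:~R * S)) *
       (X%:~R - Y%:~R * P - (Z%:~R * Q - W%:~R * S))).
  by move: P Q S N {p1 p2 p3 p4 E1 E2 E3 E4} => P1 Q1 S1 N; lra.
rewrite -(ler_int R) intrB intrM !rmorphXn /= -!pmulrn.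
move: (sqr_sqrtn (a * b)); move: P => P1 <- h.
by apply: le_trans h _; rewrite le_eqVlt; apply/orP; left; apply/eqP; ring.
Qed.

Lemma nonunit_of_norm v x y z w (n : int) : v = lincomb e1 e2 e3 x y z w ->
  in_OK v -> absnorm a b c x y z w = n%:~R -> (1 < `|n|)%N -> ~ in_OK v^-1.
Proof.
move=> vE vO nE n1 vU; have [s [[_ N _] sE]] := frame_full_embeddings R F.
have [m mE] := N _ vO; have [k kE] := N _ vU.
have mn : m = n.
  apply: (@intr_inj R); rewrite -mE -(ratr_int R n) -nE vE -prod_real_comb.
  by apply: eq_bigr => i _; rewrite sE.
have v0 : v != 0.
  apply/eqP => v0; move: mE; rewrite v0 prod_bool2 !rmorph0 !mul0r mn.
  by move/esym/eqP; rewrite intr_eq0 => /eqP n0; rewrite n0 in n1.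
have /(congr1 absz) : m * k = 1.
  apply: (@intr_inj R); rewrite intrM -mE -kE -big_split /= big1 // => i _.
  by rewrite -rmorphM mulfV // rmorph1.
by rewrite mn abszM => /eqP; rewrite muln_eq1 => /andP[/eqP n1' _]; rewrite n1' in n1.
Qed.

End FrameIntegers.

(** * Indecomposable integers coming from a quadratic subfield *)

Section QuadraticIndecomposables.

Variables (R : realType) (K : fieldExtType rat).
Variables (a b c : nat) (e1 e2 e3 : K).
Hypothesis F : frame a b c e1 e2 e3.
Implicit Types X Y Z W : int.

Local Notation P := (Num.sqrt (a * b)%:R : R).
Local Notation Q := (Num.sqrt (a * c)%:R : R).
Local Notation S := (Num.sqrt (b * c)%:R : R).
Local Notation qc := (quarter_comb e1 e2 e3).

(* [X - j Y] is, up to scaling, the trace form given by a totally positive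
   element of the codifferent of the subfield generated by e1. *)
Lemma codifferent_pos X Y (n j : nat) :
  (j ^ 2 < n)%N -> 0 < X -> Y ^+ 2 * n%:Z < X ^+ 2 -> 0 < X - j%:Z * Y.
Proof.
move=> jn X0 lt; rewrite subr_gt0.
have [Y0|Y0] := leP Y 0; first by apply: le_lt_trans X0; rewrite mulr_ge0_le0.
rewrite -ltr_sqr ?nnegrE ?(ltW X0) ?mulr_ge0 ?(ltW Y0) //.
apply: le_lt_trans lt; rewrite exprMn mulrC ler_wpM2l ?sqr_ge0 //.
by rewrite -rmorphXn /=; lia.
Qed.

(** The values of X - j Y on the two summands are at least d and add up to 2 d, so both equal d. On
    that line positivity leaves only Y = 0, 1 or 2. *)
Lemma codifferent_line X Y X' Y' (n j d : nat) :
  (j ^ 2 < n)%N -> (d <= 2 * j)%N ->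
  0 < X -> Y ^+ 2 * n%:Z < X ^+ 2 -> 0 < X' -> Y' ^+ 2 * n%:Z < X' ^+ 2 ->
  d%:Z <= X - j%:Z * Y -> d%:Z <= X' - j%:Z * Y' ->
  X + X' = 2%:Z * (j + d)%N%:Z -> Y + Y' = 2%:Z ->
  [\/ X = d%:Z /\ Y = 0, X' = d%:Z /\ Y' = 0 | X = (j + d)%N%:Z /\ Y = 1].
Proof.
move=> jn d2 X0 lt X'0 lt' h h' EX EY.
have Y'E : Y' = 2%:Z - Y by lia.
have XE : X = d%:Z + j%:Z * Y by rewrite Y'E in h'; lia.
have X'E : X' = d%:Z + j%:Z * Y' by rewrite Y'E; lia.
(* The conjugate functional U + j V = d + 2 j V is positive too, which excludes V <= -1 because d <=
   2 j. *)
have ge0 U V : U = d%:Z + j%:Z * V -> 0 < U -> V ^+ 2 * n%:Z < U ^+ 2 -> 0 <= V.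
  move=> UE U0 ltU; rewrite leNgt; apply/negP => V0.
  have ltN : (- V) ^+ 2 * n%:Z < U ^+ 2 by rewrite sqrrN.
  have := codifferent_pos jn U0 ltN; rewrite UE => {}ltU.
  have : j%:Z * V <= j%:Z * -1 by rewrite ler_wpM2l //; lia.
  by lia.
have := ge0 _ _ XE X0 lt; have := ge0 _ _ X'E X'0 lt'; rewrite Y'E => Y2 Y0.
have [Y1|[Y1|Y1]] : Y = 0 \/ Y = 1 \/ Y = 2%:Z by lia.
- by constructor 1; rewrite XE Y1 mulr0 addr0.
- by constructor 3; rewrite XE Y1; split=> //; lia.
- by constructor 2; rewrite X'E Y'E Y1; split; lia.
Qed.

Lemma in_OK_quarter2 (t n Y : int) :
  4%:Z * t ^+ 2 - (a * b)%N%:Z * Y ^+ 2 = 16%:Z * n -> in_OK (qc (2%:Z * t) Y 0 0).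
Proof.
move=> E; apply: (@in_OK_quadratic _ _ t n).
rewrite /quarter_comb lincombE /rational_comb !(mul0r, rmorph0, addr0).
set x := _ / _; set y := _ / _; set i := in_alg K.
have tE : (t%:~R : K) = 2%:R * i x.
  rewrite -(rmorph_int i) -(rmorph_nat i) -rmorphM /x intrM; congr (i _).
  by rewrite -pmulrn; field.
have nE : (n%:~R : K) = i x ^+ 2 - e1 ^+ 2 * i y ^+ 2.
  rewrite (frame_e11 F) -(rmorph_int i) -(rmorph_nat i) -!rmorphXn -rmorphM -rmorphB.
  congr (i _); rewrite /x /y.
  have : (4%:Z * t ^+ 2 - (a * b)%N%:Z * Y ^+ 2)%:~R = (16%:Z * n)%:~R :> rat by rewrite E.
  rewrite intrB !(rmorphXn, intrM) /= -!pmulrn => E'; lra.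
by rewrite tE nE; ring.
Qed.

Lemma decomposition_coords X Y (y z : K) :
  in_OKplus R y -> in_OKplus R z -> qc X Y 0 0 = y + z ->
  exists X1 Y1 X2 Y2 Z W,
  [/\ X = X1 + X2, Y = Y1 + Y2,
      [/\ y = qc X1 Y1 Z W, norm_mod4 (a * b) X1 Y1,
          norm_mod4 (a * c) X1 Z & norm_mod4 (b * c) X1 W]
    & z = qc X2 Y2 (- Z) (- W) /\ norm_mod4 (a * b) X2 Y2].
Proof.
move=> [yO _] [zO _].
have [X1 [Y1 [Z [W [-> m1 m2 m3]]]]] := in_OK_quarter R F yO.
have [X2 [Y2 [Z' [W' [-> m1' _ _]]]]] := in_OK_quarter R F zO.
rewrite quarter_combD => /(quarter_comb_inj F)[-> -> EZ EW].
exists X1, Y1, X2, Y2, Z, W; split=> //; split=> //.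
by congr (qc _ _ _ _); lia.
Qed.

Lemma trace1_not_integer Z W : ~ in_OKplus R (qc 2%:Z 0 Z W).
Proof. by move=> /(quarter_norm_bound F); rewrite expr0n /= mulr0. Qed.

Lemma quarter_quadratic_pos X Y :
  0 < X -> Y ^+ 2 * (a * b)%N%:Z < X ^+ 2 -> totally_positive R (qc X Y 0 0).
Proof.
move=> X0 lt; apply/(quarter_comb_pos R F); rewrite /quarter_pos !mul0r addr0 subr0 !addr0 !subr0.
have : `|Y%:~R * P| < X%:~R.
  rewrite -ltr_sqr ?nnegrE ?normr_ge0 ?ler0z ?(ltW X0) // real_normK ?num_real //.
  by rewrite exprMn sqr_sqrtn -!rmorphXn /=; move: lt; rewrite -(ltr_int R) intrM.
by rewrite ltr_norml => /andP[]; move: P => P1 *; split; lra.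
Qed.

End QuadraticIndecomposables.

Section SubfieldIndecomposables.

Variables (R : realType) (K : fieldExtType rat).
Variables (a b c : nat) (e1 e2 e3 : K).
Hypothesis F : frame a b c e1 e2 e3.
Implicit Types X Y Z W : int.

Local Notation P := (Num.sqrt (a * b)%:R : R).
Local Notation Q := (Num.sqrt (a * c)%:R : R).
Local Notation S := (Num.sqrt (b * c)%:R : R).
Local Notation qc := (quarter_comb e1 e2 e3).

Lemma frame_prod_gt0 : [/\ (0 < a * b)%N, (0 < a * c)%N & (0 < b * c)%N].
Proof. by case: (frame_gt0 F) => ? ? ?; rewrite !muln_gt0; split; apply/andP. Qed.

(** As k + 1 - sqrt(ab) is less than 1, it leaves no room for a nonzero multiple of a single further
    square root. *)
Lemma quarter_pos_even_small X Y Z W (k : nat) :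
  quarter_pos R a b c X Y (2%:Z * Z) (2%:Z * W) -> (k ^ 2 < a * b)%N ->
  X = 2%:Z * k.+1%:Z -> Y = 2%:Z -> Z = 0 \/ W = 0 -> Z = 0 /\ W = 0.
Proof.
rewrite /quarter_pos => -[_ _ p3 p4] kp XE YE.
have kP : k%:R < P.
  rewrite -ltr_sqr ?nnegrE ?ler0n ?sqrtr_ge0 // sqr_sqrtn -natrX ltr_nat //.
have lt2 : `|(2%:Z * Z)%:~R * Q - (2%:Z * W)%:~R * S| < (2%:Z)%:~R.
  move: p3 p4; rewrite ltr_norml XE YE !intrM -!pmulrn -[k.+1]addn1 natrD.
  by move: P Q S kP => P1 Q1 S1 kP p3 p4; apply/andP; split; lra.
have [_ q0 r0] := frame_prod_gt0.
have zero (T : int) (n : nat) : (0 < n)%N -> `|(2%:Z * T)%:~R * Num.sqrt n%:R| < (2%:Z)%:~R :> R -> T = 0.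
  move=> n0 /(int_sqrt_lt (isT : 0 < 2%:Z)); rewrite exprMn => h.
  have n1 : 1 <= n%:Z by lia.
  have : T ^+ 2 * 1 <= T ^+ 2 * n%:Z by rewrite ler_wpM2l ?sqr_ge0.
  rewrite mulr1 => h'; have {h h'} T1 : T ^+ 2 < 1 by lia.
  by apply/eqP; rewrite -sqrf_eq0; have := sqr_ge0 T; lia.
case=> E; move: lt2; rewrite E mulr0 mul0r ?sub0r ?subr0 ?normrN => /zero h; split=> //.
  exact: h.
exact: h.
Qed.

Lemma quarter_absnorm X Y :
  absnorm a b c (X%:~R / 4%:R) (Y%:~R / 4%:R) (0%:~R / 4%:R) (0%:~R / 4%:R) =
    ((X ^+ 2 - (a * b)%N%:Z * Y ^+ 2) ^+ 2)%:~R / 256%:R.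
Proof.
rewrite /absnorm /relnorm_rat /relnorm_irr rmorphXn /= intrB !(rmorphXn, intrM) /= -!pmulrn.
by field.
Qed.

(** Summands could only be (k + 1 + sqrt(ab) + Z sqrt(ac) + W sqrt(bc))/2 and its relative
    conjugate. A radicand of at least (k + 1)^2 kills Z or W, hence both, and the bare half is not
    an integer. *)
Lemma root_indecomposable (k : nat) :
  ((a * b) %% 4 <> 1)%N -> (k ^ 2 < a * b < k.+1 ^ 2)%N ->
  ~~ ((a * c < k.+1 ^ 2)%N && (b * c < k.+1 ^ 2)%N) ->
  indecomposable_integer R (qc (4%:Z * k.+1%:Z) 4%:Z 0 0).
Proof.
move=> p4 /andP[kp pk] qr; have [p0 q0 r0] := frame_prod_gt0.
have k1 : (1 <= k)%N by have := frame_gt1 F; case: k pk {kp qr} => //; lia.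
split.
  split.
    have -> : 4%:Z * k.+1%:Z = 2%:Z * (2%:Z * k.+1%:Z) by lia.
    by apply: (in_OK_quarter2 F (n := k.+1%:Z ^+ 2 - (a * b)%N%:Z)); ring.
  refine (quarter_quadratic_pos F _ _) => //; rewrite exprMn.
  have : k.+1%:Z ^+ 2 = (k.+1 ^ 2)%N%:Z by rewrite expr2 -PoszM mulnn.
  by lia.
move=> y z yO zO E.
have [X1 [Y1 [X2 [Y2 [Z [W [EX EY [yE m1 m2 m3] [zE m1']]]]]]]] :=
  decomposition_coords F yO zO E.
have [_ y_pos] := yO; have [_ z_pos] := zO; rewrite yE in yO y_pos; rewrite zE in zO z_pos.
move: y_pos z_pos => /(quarter_comb_pos R F) y_pos /(quarter_comb_pos R F) z_pos.
have sq1 := frame_sqf12 F; have sq2 := frame_sqf13 F; have sq3 := frame_sqf23 F.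
have [[A XA] [B YB]] := norm_mod4_even sq1 m1 (or_introl p4).
have [[A' XA'] [B' YB']] := norm_mod4_even sq1 m1' (or_introl p4).
have [_ [Z1 ZE]] := norm_mod4_even sq2 m2 (or_intror (ex_intro _ A XA)).
have [_ [W1 WE]] := norm_mod4_even sq3 m3 (or_intror (ex_intro _ A XA)).
subst X1 Y1 X2 Y2 Z W.
have [X0 bY bZ bW] := quarter_pos_bounds y_pos.
have [X0' bY' _ _] := quarter_pos_bounds z_pos.
have A0 : 0 < A by move: X0; clear; lia.
have A0' : 0 < A' by move: X0'; clear; lia.
have bB : B ^+ 2 * (a * b)%N%:Z < A ^+ 2 by move: bY; rewrite !exprMn; clear; lia.
have bB' : B' ^+ 2 * (a * b)%N%:Z < A' ^+ 2 by move: bY'; rewrite !exprMn; clear; lia.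
have cA := codifferent_pos kp A0 bB; have cA' := codifferent_pos kp A0' bB'.
have [|||||[A1 B1]|[A1 B1]|[A1 B1]] := @codifferent_line A B A' B' (a * b) k 1 kp _ A0 bB A0' bB'.
- by move: k1; clear; lia.
- by move: cA; clear; lia.
- by move: cA'; clear; lia.
- by move: EX; clear; lia.
- by move: EY; clear; lia.
- by move: yO; rewrite A1 B1; apply: (trace1_not_integer F (R := R)).
- by move: zO; rewrite A1 B1; apply: (trace1_not_integer F (R := R)).
rewrite addn1 in A1.
have small (T : int) (n : nat) : (2%:Z * T) ^+ 2 * n%:Z < (2%:Z * A) ^+ 2 ->
    (k.+1 ^ 2 <= n)%N -> T = 0.
  move=> h nk; apply/eqP; rewrite -sqrf_eq0; apply/negPn/negP => T0.
  have T1 : 1 <= T ^+ 2 by have := sqr_ge0 T; move: T0; clear; lia.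
  have : 1 * n%:Z <= T ^+ 2 * n%:Z by rewrite ler_wpM2r.
  move: h nk; rewrite !exprMn A1; have : k.+1%:Z ^+ 2 = (k.+1 ^ 2)%N%:Z by rewrite expr2 -PoszM mulnn.
  by clear; lia.
have ZW : Z1 = 0 \/ W1 = 0.
  by move: qr; rewrite negb_and -!leqNgt => /orP[/(small _ _ bZ)|/(small _ _ bW)]; [left|right].
have [Z10 W10] := quarter_pos_even_small y_pos kp (congr1 _ A1) (congr1 _ B1) ZW.
case: yO => yO _; rewrite Z10 W10 A1 B1 mulr0 in yO.
(* The bare half would have norm ((k + 1)^2 - ab)^2 / 16, impossible since ab is 2 or 3 modulo 4. *)
have [n] := absnorm_int R F yO; rewrite quarter_absnorm => nE.
have {nE} nE : (k.+1%:Z ^+ 2 - (a * b)%N%:Z) ^+ 2 = 16%:Z * n.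
  apply: (@intr_inj rat); rewrite [in RHS]intrM -nE.
  have -> : (2%:Z * k.+1%:Z) ^+ 2 - (a * b)%N%:Z * (2%:Z * 1) ^+ 2 =
    4%:Z * (k.+1%:Z ^+ 2 - (a * b)%N%:Z) by ring.
  by rewrite !rmorphXn /= [in RHS]intrM -pmulrn; field.
have [s [i sE sP]] := sqr_mod4 k.+1%:Z; have := squarefree_mod4 sq1.
have := divn_eq (a * b) 4; rewrite sE in nE; move: ((a * b) %/ 4)%N => u pE p00.
have pZ : (a * b)%N%:Z = 4%:Z * u%:Z + ((a * b) %% 4)%N%:Z by move: pE; clear; lia.
rewrite pZ in nE.
have [t tE] : exists2 t : int, t * 4%:Z + i - ((a * b) %% 4)%N%:Z =
    4%:Z * s + i - (4%:Z * u%:Z + ((a * b) %% 4)%N%:Z) & True by exists (s - u%:Z) => //; clear; ring.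
rewrite -tE in nE.
have r3 : (a * b %% 4 < 4)%N by rewrite ltn_mod.
move: ((a * b) %% 4)%N p4 p00 r3 nE {pE pZ tE} => r p4 p00 r3 nE _.
have [rE|rE] : r = 2%N \/ r = 3%N by move: p4 p00 r3; clear; lia.
all: by rewrite rE in nE; case: sP nE => -[-> _]; clear; lia.
Qed.

End SubfieldIndecomposables.

Section SubfieldForms.

Variables (R : realType) (K : fieldExtType rat).
Variables (a b c : nat) (e1 e2 e3 : K).
Hypothesis F : frame a b c e1 e2 e3.
Implicit Types X Y Z W : int.

Local Notation qc := (quarter_comb e1 e2 e3).

Lemma root_form (k : nat) :
  ((a * b) %% 4 <> 1)%N -> (k ^ 2 < a * b < k.+1 ^ 2)%N -> (a * b).+1 <> (k.+1 ^ 2)%N ->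
  ~~ ((a * c < k.+1 ^ 2)%N && (b * c < k.+1 ^ 2)%N) ->
  exists q : 'M[K]_2, additively_indecomposable R q.
Proof.
move=> p4 kp pk qr; have ind := root_indecomposable R F p4 kp qr.
have [s [sP _]] := frame_full_embeddings R F.
apply: (indecomposable_form_of_integer (false, false) sP ind).
case: ind => -[vO _] _.
apply: (nonunit_of_norm R F erefl vO (n := (k.+1%:Z ^+ 2 - (a * b)%N%:Z) ^+ 2)).
  rewrite quarter_absnorm.
  have -> : (4%:Z * k.+1%:Z) ^+ 2 - (a * b)%N%:Z * 4%:Z ^+ 2 =
    16%:Z * (k.+1%:Z ^+ 2 - (a * b)%N%:Z) by ring.
  by rewrite !rmorphXn /= [in LHS]intrM -pmulrn; field.
have E : k.+1%:Z ^+ 2 = (k.+1 ^ 2)%N%:Z by rewrite expr2 -PoszM mulnn.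
have h : 2%:Z <= k.+1%:Z ^+ 2 - (a * b)%N%:Z.
  by rewrite E; move: kp pk; clear; lia.
by rewrite abszX; move: (_ - _) h; clear => t h; nia.
Qed.

(** A summand of the third kind has the odd numerator j + 2. Integrality then forces the other
    radicands to be 1 modulo 4 with odd, hence nonzero, coordinates, and positivity bounds these
    radicands by (j + 2)^2. *)
Lemma half_root_indecomposable (j : nat) :
  odd j -> ((a * b) %% 4 = 1)%N -> (j ^ 2 < a * b < j.+2 ^ 2)%N ->
  ~~ [&& (a * c) %% 4 == 1, (b * c) %% 4 == 1, a * c < j.+2 ^ 2 & b * c < j.+2 ^ 2]%N ->
  indecomposable_integer R (qc (2%:Z * j.+2%:Z) 2%:Z 0 0).
Proof.
move=> jo p4 /andP[jp pj] qr; have [p0 q0 r0] := frame_prod_gt0 F.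
have [l jl] : exists l : nat, j = (2 * l).+1.
  by exists j./2; move: jo; clear; lia.
have mE : j.+2%:Z ^+ 2 = (j.+2 ^ 2)%N%:Z by rewrite expr2 -PoszM mulnn.
split.
  split.
    apply: (in_OK_quarter2 F (n := (l + 1)%N%:Z * (l + 2)%N%:Z - ((a * b) %/ 4)%N%:Z)).
    have := divn_eq (a * b) 4; rewrite p4 jl; move: ((a * b) %/ 4)%N => u ->.
    by clear; rewrite !PoszD !PoszM; lia.
  refine (quarter_quadratic_pos F _ _) => //; rewrite exprMn mE.
  by move: pj; clear; lia.
move=> y z yO zO E.
have [X1 [Y1 [X2 [Y2 [Z [W [EX EY [yE m1 m2 m3] [zE m1']]]]]]]] :=
  decomposition_coords F yO zO E.
have [_ y_pos] := yO; have [_ z_pos] := zO; rewrite yE in yO y_pos; rewrite zE in zO z_pos.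
move: y_pos z_pos => /(quarter_comb_pos R F) y_pos /(quarter_comb_pos R F) z_pos.
have [X0 bY bZ bW] := quarter_pos_bounds y_pos.
have [X0' bY' _ _] := quarter_pos_bounds z_pos.
have cA := codifferent_pos jp X0 bY; have cA' := codifferent_pos jp X0' bY'.
(* U and V have the same parity and j is odd, so the functional takes even values and its least
   positive one is d = 2. *)
have ge2 (U V : int) : norm_mod4 (a * b) U V -> 0 < U - j%:Z * V -> 2%:Z <= U - j%:Z * V.
  move=> /(norm_mod4_parity p4)[h UV]; have -> : U = V + 2%:Z * h by move: UV; clear; lia.
  by rewrite jl; clear; lia.
have j2 : (2 <= 2 * j)%N by rewrite jl; clear; lia.
have [||[A1 B1]|[A1 B1]|[A1 B1]] := codifferent_line jp j2 X0 bY X0' bY' (ge2 _ _ m1 cA) (ge2 _ _ m1' cA').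
- by move: EX; clear; lia.
- by move: EY; clear; lia.
- by move: yO; rewrite A1 B1; apply: (trace1_not_integer F (R := R)).
- by move: zO; rewrite A1 B1; apply: (trace1_not_integer F (R := R)).
rewrite addn2 in A1; case/negP: qr.
have odd_bound n V : squarefree n -> norm_mod4 n X1 V -> V ^+ 2 * n%:Z < X1 ^+ 2 ->
    (n %% 4 == 1)%N && (n < j.+2 ^ 2)%N.
  move=> nsq mV bV.
  have odd_X1 : ~ exists h : int, X1 = 2%:Z * h.
    by case=> h; rewrite A1 jl; clear; lia.
  have [n4|n4] := eqVneq (n %% 4)%N 1%N; last first.
    by case: odd_X1; case: (norm_mod4_even nsq mV (or_introl _)) => //; apply/eqP.
  have [h VE] := norm_mod4_parity n4 mV.
  have V0 : V != 0.
    by apply/eqP => V0; apply: odd_X1; exists h; move: VE; rewrite V0; clear; lia.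
  have V1 : 1 <= V ^+ 2 by move: V0; rewrite -sqrf_eq0; have := sqr_ge0 V; clear; lia.
  have : 1 * n%:Z <= V ^+ 2 * n%:Z by rewrite ler_wpM2r.
  by move: bV; rewrite A1 mE; clear; lia.
have /andP[-> ->] := odd_bound _ _ (frame_sqf13 F) m2 bZ.
by have /andP[-> ->] := odd_bound _ _ (frame_sqf23 F) m3 bW.
Qed.

Lemma half_root_form (j : nat) :
  odd j -> ((a * b) %% 4 = 1)%N -> (j ^ 2 < a * b < j.+2 ^ 2)%N ->
  (a * b + 4)%N <> (j.+2 ^ 2)%N ->
  ~~ [&& (a * c) %% 4 == 1, (b * c) %% 4 == 1, a * c < j.+2 ^ 2 & b * c < j.+2 ^ 2]%N ->
  exists q : 'M[K]_2, additively_indecomposable R q.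
Proof.
move=> jo p4 jp pj qr; have ind := half_root_indecomposable jo p4 jp qr.
have [s [sP _]] := frame_full_embeddings R F.
apply: (indecomposable_form_of_integer (false, false) sP ind).
case: ind => -[vO _] _.
have [l jl] : exists l : nat, j = (2 * l).+1.
  by exists j./2; move: jo; clear; lia.
have mE : j.+2%:Z ^+ 2 = (j.+2 ^ 2)%N%:Z by rewrite expr2 -PoszM mulnn.
have [n nE] : exists n : int, j.+2%:Z ^+ 2 - (a * b)%N%:Z = 4%:Z * n.
  exists ((l + 1)%N%:Z * (l + 2)%N%:Z - ((a * b) %/ 4)%N%:Z).
  have := divn_eq (a * b) 4; rewrite p4 jl; move: ((a * b) %/ 4)%N => u ->.
  by clear; rewrite !PoszD !PoszM; lia.
apply: (nonunit_of_norm R F erefl vO (n := n ^+ 2)).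
  rewrite quarter_absnorm.
  have -> : (2%:Z * j.+2%:Z) ^+ 2 - (a * b)%N%:Z * 2%:Z ^+ 2 = 16%:Z * n.
    have -> : 16%:Z * n = 4%:Z * (4%:Z * n) by clear; ring.
    by rewrite -nE; clear; ring.
  by rewrite !rmorphXn /= [in LHS]intrM -pmulrn; field.
have h : 2%:Z <= n.
  by move: nE; rewrite mE; move: jp pj; clear; lia.
by rewrite abszX; move: h; clear; nia.
Qed.

End SubfieldForms.

(** * Totally positive units that are not squares *)

Lemma squarefree_rat_eq (n N M : nat) (t : rat) :
  squarefree n -> squarefree N -> (M %| N)%N -> n%:R * t ^+ 2 = M%:R -> M = n.
Proof.
move=> nsq Nsq MN tE; have [T TE] := @squarefree_rat n t M%:Z nsq tE.
have E : (n * `|T| ^ 2 = M)%N.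
  have : n%:Z * T ^+ 2 = M%:Z.
    by apply: (@intr_inj rat); rewrite intrM rmorphXn /= -TE -!pmulrn.
  by move/(congr1 absz); rewrite abszM abszX.
have T1 : `|T|%N = 1%N by apply: Nsq; apply: dvdn_trans MN; rewrite -E dvdn_mull.
by rewrite -E T1 muln1.
Qed.

Section UnitForms.

Variables (R : realType) (K : fieldExtType rat).
Variables (a b c : nat) (e1 e2 e3 : K).
Hypothesis F : frame a b c e1 e2 e3.

Local Notation qc := (quarter_comb e1 e2 e3).

(** Over the reals the unit is the square of (sqrt j + sqrt(j + 4))/2, so it can be a square in K
    only if j and j + 4 are the two other radicands. *)
Lemma half_unit_not_square (j : nat) (v : K) :
  (a * b = j * (j + 4))%N -> (1 < j)%N ->
  ~ (a * c = j /\ b * c = j + 4)%N -> ~ (a * c = j + 4 /\ b * c = j)%N ->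
  qc (2%:Z * j.+2%:Z) 2%:Z 0 0 <> v ^+ 2.
Proof.
move=> pE j1 no1 no2.
have [x [y [z [w ->]]]] := frame_span F v.
rewrite /quarter_comb expr2 (lincombM F) => /(lincomb_inj F)[].
rewrite mul0r intrM -!pmulrn -[j.+2]addn2 natrD => Ex Ey Ez Ew.
have jd : (j %| a * b)%N by rewrite pE dvdn_mulr.
have j4d : (j + 4 %| a * b)%N by rewrite pE dvdn_mull.
have pR : (a * b)%:R = j%:R * (j%:R + 4%:R) :> rat by rewrite pE natrM natrD.
have abR : (a * b)%:R = a%:R * b%:R :> rat by rewrite natrM.
have acR : (a * c)%:R = a%:R * c%:R :> rat by rewrite natrM.
have bcR : (b * c)%:R = b%:R * c%:R :> rat by rewrite natrM.
have sq1 : squarefree 1 by move=> d; rewrite dvdn1 => /eqP; case: d => [|[|]].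
have pm (t : rat) : t ^+ 2 = 1 -> t = 1 \/ t = -1.
  by move/eqP; rewrite -[X in _ == X](expr1n _ 2) eqf_sqr => /orP[]/eqP; [left|right].
have irr := squarefree_irrational (frame_sqf12 F) (frame_gt1 F).
have xz : x * z = - (b%:R * (y * w)) by lra.
have xw : x * w = - (a%:R * (y * z)) by lra.
have zirr : z * (x ^+ 2 - (a * b)%:R * y ^+ 2) = 0.
  have -> : z * (x ^+ 2 - (a * b)%:R * y ^+ 2) = (x * z) * x - (a * b)%:R * y ^+ 2 * z by ring.
  rewrite xz; have -> : - (b%:R * (y * w)) * x = - (b%:R * y * (x * w)) by ring.
  by rewrite xw abR; ring.
have wirr : w * (x ^+ 2 - (a * b)%:R * y ^+ 2) = 0.
  have -> : w * (x ^+ 2 - (a * b)%:R * y ^+ 2) = (x * w) * x - (a * b)%:R * y ^+ 2 * w by ring.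
  rewrite xw; have -> : - (a%:R * (y * z)) * x = - (a%:R * y * (x * z)) by ring.
  by rewrite xz abR; ring.
(* As the square has no e2 and e3 coordinates, its root is a combination either of e2, e3 or of 1,
   e1. *)
case: (eqVneq (x ^+ 2 - (a * b)%:R * y ^+ 2) 0) => [/eqP|ne0].
  rewrite subr_eq0 => /eqP E; have y0 := irr _ _ E.
  have x0 : x = 0 by move/eqP: E; rewrite y0 expr0n /= mulr0 sqrf_eq0 => /eqP.
  subst x y.
  have zw : c%:R * (z * w) = 1 / 4%:R by lra.
  have nE : (a * c)%:R * z ^+ 2 + (b * c)%:R * w ^+ 2 = (j%:R + 2%:R) / 2%:R by lra.
  (* The sum and difference of the two terms make a c (2 z)^2 equal to j or j + 4. *)
  have : ((a * c)%:R * z ^+ 2 - (b * c)%:R * w ^+ 2) ^+ 2 = 1.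
    have -> : ((a * c)%:R * z ^+ 2 - (b * c)%:R * w ^+ 2) ^+ 2 =
      ((a * c)%:R * z ^+ 2 + (b * c)%:R * w ^+ 2) ^+ 2 - 4%:R * (a * b)%:R * (c%:R * (z * w)) ^+ 2.
      by rewrite acR bcR abR; ring.
    by rewrite nE zw pR; field.
  case/pm => E1.
  - apply: no2; split.
      apply/esym/(squarefree_rat_eq (t := 2%:R * z) (frame_sqf13 F) (frame_sqf12 F) j4d).
      by rewrite natrD; lra.
    apply/esym/(squarefree_rat_eq (t := 2%:R * w) (frame_sqf23 F) (frame_sqf12 F) jd).
    by lra.
  - apply: no1; split.
      apply/esym/(squarefree_rat_eq (t := 2%:R * z) (frame_sqf13 F) (frame_sqf12 F) jd).
      by lra.
    apply/esym/(squarefree_rat_eq (t := 2%:R * w) (frame_sqf23 F) (frame_sqf12 F) j4d).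
    by rewrite natrD; lra.
have z0 : z = 0 by move/eqP: zirr; rewrite mulf_eq0 (negbTE ne0) orbF => /eqP.
have w0 : w = 0 by move/eqP: wirr; rewrite mulf_eq0 (negbTE ne0) orbF => /eqP.
subst z w.
have xy : x * y = 1 / 4%:R by lra.
have nE : x ^+ 2 + (a * b)%:R * y ^+ 2 = (j%:R + 2%:R) / 2%:R by lra.
have : (x ^+ 2 - (a * b)%:R * y ^+ 2) ^+ 2 = 1.
  have -> : (x ^+ 2 - (a * b)%:R * y ^+ 2) ^+ 2 =
    (x ^+ 2 + (a * b)%:R * y ^+ 2) ^+ 2 - 4%:R * (a * b)%:R * (x * y) ^+ 2 by ring.
  by rewrite nE xy pR; field.
case/pm => E1.
- have : (j + 4 = 1)%N; last by lia.
  apply: (squarefree_rat_eq (t := 2%:R * x) sq1 (frame_sqf12 F) j4d).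
  by rewrite natrD; lra.
- have : (j = 1)%N; last by lia.
  apply: (squarefree_rat_eq (t := 2%:R * x) sq1 (frame_sqf12 F) jd).
  by lra.
Qed.

Lemma half_unit_form (j : nat) :
  odd j -> (a * b = j * (j + 4))%N -> (1 < j)%N ->
  ~ (a * c = j /\ b * c = j + 4)%N -> ~ (a * c = j + 4 /\ b * c = j)%N ->
  exists q : 'M[K]_2, additively_indecomposable R q.
Proof.
move=> jo pE j1 no1 no2; set v := qc (2%:Z * j.+2%:Z) 2%:Z 0 0.
have [l jl] : exists l : nat, j = (2 * l).+1.
  by exists j./2; move: jo; clear; lia.
have vO : in_OK v.
  apply: (in_OK_quarter2 F (n := 1)); rewrite pE PoszM; clear.
  by rewrite -addn2 !PoszD; ring.
have vp : totally_positive R v.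
  refine (quarter_quadratic_pos F _ _) => //; rewrite pE PoszM; clear.
  by rewrite -addn2 !PoszD; lia.
have [s [sP _]] := frame_full_embeddings R F.
pose m : K := j.+2%:R.
have v2 : v ^+ 2 = m * v - 1.
  rewrite /v /quarter_comb lincombE /rational_comb !(mul0r, rmorph0, addr0).
  set x := _ / _; set y := _ / _; set i := in_alg K.
  have mE : m = 2%:R * i x.
    rewrite /m -(rmorph_nat i j.+2) -(rmorph_nat i 2) -rmorphM /x intrM; congr (i _).
    by rewrite -!pmulrn; field.
  have -> : (1 : K) = i x ^+ 2 - e1 ^+ 2 * i y ^+ 2.
    rewrite (frame_e11 F) -(rmorph_nat i) -(rmorph1 i) -!rmorphXn -rmorphM -rmorphB.
    congr (i _); rewrite /x /y pE natrM natrD intrM -!pmulrn -[j.+2]addn2 natrD.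
    by field.
  by rewrite mE; ring.
have v0 : v != 0 by rewrite -(fmorph_eq0 (s (false, false))) gt_eqF ?vp.
have vV : v^-1 = m - v.
  apply: (mulfI v0); rewrite mulfV //.
  have -> : v * (m - v) = m * v - v ^+ 2 by ring.
  by rewrite v2; ring.
(* The choice b = v^2 works because m is odd: modulo 2, v^2 = v + 1, hence v^4 = v and v + b^2 is
   even. *)
apply: (indecomposable_form_of_unit (false, false) sP (d := v) (b := v ^+ 2)) => //.
- by rewrite vV; apply: in_OKB => //; apply: in_OK_nat.
- exact: in_OKX.
- have two0 := natK_neq0 K 1.
  pose L : K := l%:R.
  have mL : m = 2%:R * L + 3%:R by rewrite /m /L jl -natrM -natrD; congr (_%:R); lia.
  have -> : (v + (v ^+ 2) ^+ 2) / 2%:R =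
      (4%:R * L ^+ 3 + 18%:R * L ^+ 2 + 25%:R * L + 11%:R) * v
      - (2%:R * L ^+ 2 + 6%:R * L + 4%:R).
    apply: (mulIf two0); rewrite divfK //.
    have -> : (v ^+ 2) ^+ 2 = m ^+ 2 * v ^+ 2 - 2%:R * m * v + 1 by rewrite {1}v2; ring.
    by rewrite v2 mL; ring.
  have LO := in_OK_nat K l.
  by repeat first [assumption | apply: in_OK_nat | apply: in_OKX | apply: in_OKB
                  | apply: in_OKD | apply: in_OKM].
- by move=> w; apply: half_unit_not_square.
Qed.

End UnitForms.

(** * The radicands 5, t, 5t and the golden ratio *)

Lemma coprime_mul_square (x y z : nat) :
  (0 < x)%N -> coprime x y -> (x * y = z ^ 2)%N -> exists s : nat, x = (s ^ 2)%N.
Proof.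
move=> x0 cxy E; pose g := gcdn x z.
have g0 : (0 < g)%N by rewrite gcdn_gt0 x0.
have [x1 xE] := dvdnP (dvdn_gcdl x z); have [z1 zE] := dvdnP (dvdn_gcdr x z).
rewrite -/g in xE zE.
have c1 : coprime x1 z1.
  have : (gcdn x1 z1 * g == 1 * g)%N by rewrite muln_gcdl -xE -zE mul1n.
  by rewrite eqn_pmul2r.
have E1 : (x1 * y = g * z1 ^ 2)%N.
  by apply/eqP; rewrite -(eqn_pmul2l g0) mulnA [(g * x1)%N]mulnC -xE E zE; apply/eqP; ring.
have d1 : (x1 %| g)%N.
  by rewrite -(@Gauss_dvdl _ _ (z1 ^ 2)) -?E1 ?dvdn_mulr // coprimeXr.
have d2 : (g %| x1)%N.
  rewrite -(@Gauss_dvdl _ _ y) ?E1 ?dvdn_mulr //.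
  by apply: coprime_dvdl cxy; apply: dvdn_gcdl.
exists g; rewrite xE -mulnn; congr (_ * _)%N; apply/eqP; by rewrite eqn_dvd d1 d2.
Qed.

Lemma sqr_mod4_neq3 (s : nat) : (s ^ 2 %% 4 <> 3)%N.
Proof.
rewrite -modnXm; have : (s %% 4 < 4)%N by rewrite ltn_mod.
by case: (s %% 4)%N => [|[|[|[|]]]].
Qed.

(** The two factors are coprime and 3 modulo 4, and the one prime to 5 would be a square. This will
    exclude norm 1 in the golden twist. *)
Lemma five_squares (n f : nat) :
  ~~ odd n -> (0 < n)%N -> ((2 * n - 1) * (2 * n + 3) <> 5 * f ^ 2)%N.
Proof.
move=> ne n0 E; set u := (2 * n - 1)%N in E; set v := (2 * n + 3)%N in E.
have u4 : (u %% 4 = 3)%N by rewrite /u; lia.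
have v4 : (v %% 4 = 3)%N by rewrite /v; lia.
have uo : odd u by rewrite /u; lia.
have cuv : coprime u v.
  have -> : v = (u + 4)%N by rewrite /u /v; lia.
  by rewrite /coprime gcdnDl -/(coprime u (2 ^ 2)) coprimeXr // coprimen2.
have : (5 %| u * v)%N by rewrite E dvdn_mulr.
rewrite Euclid_dvdM // => /orP[] /dvdnP[w wE].
- have [|||s sE] := @coprime_mul_square v w f.
  + by rewrite /v; lia.
  + by rewrite coprime_sym; apply: coprime_dvdl cuv; rewrite wE dvdn_mulr.
  + by rewrite wE in E; nia.
  by move: v4; rewrite sE; apply: sqr_mod4_neq3.
- have [|||s sE] := @coprime_mul_square u w f.
  + by rewrite /u; lia.
  + by apply: coprime_dvdr cuv; rewrite wE dvdn_mulr.
  + by rewrite wE in E; nia.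
  by move: u4; rewrite sE; apply: sqr_mod4_neq3.
Qed.

Section IntegerParity.

Variables (R : realType) (K : fieldExtType rat).
Variables (a b c : nat) (e1 e2 e3 : K).
Hypothesis F : frame a b c e1 e2 e3.

Lemma relnorm_int x y z w : in_OK (lincomb e1 e2 e3 x y z w) ->
  exists n : int, 2%:R * relnorm_rat a b c x y z w = n%:~R.
Proof.
have [s [_ sE]] := frame_full_embeddings R F => vO; apply: (@ratr_integral R).
have O i : integralOver (intr : int -> R) (real_comb R a b c i x y z w).
  by rewrite -sE; apply: rmorph_in_OK.
have [E1 E2] := real_comb_relnorm R a b c x y z w.
have -> : ratr (2%:R * relnorm_rat a b c x y z w) =
  real_comb R a b c (false, false) x y z w * real_comb R a b c (false, true) x y z w +
  real_comb R a b c (true, false) x y z w * real_comb R a b c (true, true) x y z w.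
  by rewrite E1 E2 rmorphM /= ratr_nat; ring.
by apply: integral_add; apply: integral_mul.
Qed.

(** The relative norm (A + B sqrt(ab))/2 is an integer, so A and B have the same parity; together
    with the formula for 2 A modulo 4 this excludes all other parity patterns. *)
Lemma half_coords_parity (x y z w : int) :
  ((a * b) %% 4 = 1)%N -> ((a * c) %% 4 = 3)%N -> ((b * c) %% 4 = 3)%N ->
  in_OK (quarter_comb e1 e2 e3 (2%:Z * x) (2%:Z * y) (2%:Z * z) (2%:Z * w)) ->
  (exists h : int, x - y = 2%:Z * h) /\ (exists h : int, z - w = 2%:Z * h).
Proof.
move=> p4 q4 r4 vO; have [A AE] := relnorm_int vO; have [n nE] := absnorm_int R F vO.
pose B := x * y - c%:Z * (z * w).
have half4 (t : int) : (2%:Z * t)%:~R / 4%:R = t%:~R / 2%:R :> rat.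
  by rewrite intrM -pmulrn; field.
have {}AE : x ^+ 2 + (a * b)%N%:Z * y ^+ 2 - (a * c)%N%:Z * z ^+ 2 - (b * c)%N%:Z * w ^+ 2
    = 2%:Z * A.
  apply: (@intr_inj rat); move: AE; rewrite /relnorm_rat !half4 !(intrB, intrD) => AE.
  by rewrite !(rmorphXn, intrM) /= -!pmulrn; lra.
have {}nE : norm_mod4 (a * b) A B.
  exists n; apply: (@intr_inj rat); rewrite intrB [in RHS]intrM -nE /absnorm.
  have -> : relnorm_rat a b c ((2%:Z * x)%:~R / 4%:R) ((2%:Z * y)%:~R / 4%:R)
     ((2%:Z * z)%:~R / 4%:R) ((2%:Z * w)%:~R / 4%:R) = A%:~R / 2%:R.
    move: (congr1 (intr : int -> rat) AE); rewrite /relnorm_rat !half4.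
    rewrite !(intrB, intrD) !(rmorphXn, intrM) /= -!pmulrn => AE'; lra.
  have -> : relnorm_irr c ((2%:Z * x)%:~R / 4%:R) ((2%:Z * y)%:~R / 4%:R)
     ((2%:Z * z)%:~R / 4%:R) ((2%:Z * w)%:~R / 4%:R) = B%:~R / 2%:R.
    by rewrite /relnorm_irr !half4 /B intrB !intrM -!pmulrn; field.
  by rewrite !(rmorphXn, intrM) /= -!pmulrn; field.
have [h hE] := norm_mod4_parity p4 nE; rewrite /B in hE.
have [u1 [i1 uE1 uP1]] := sqr_mod4 x; have [u2 [i2 uE2 uP2]] := sqr_mod4 y.
have [u3 [i3 uE3 uP3]] := sqr_mod4 z; have [u4 [i4 uE4 uP4]] := sqr_mod4 w.
have pE : (a * b)%N%:Z = 4%:Z * ((a * b) %/ 4)%N%:Z + 1.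
  by have := divn_eq (a * b) 4; rewrite p4; clear; lia.
have qE : (a * c)%N%:Z = 4%:Z * ((a * c) %/ 4)%N%:Z + 3%:Z.
  by have := divn_eq (a * c) 4; rewrite q4; clear; lia.
have rE : (b * c)%N%:Z = 4%:Z * ((b * c) %/ 4)%N%:Z + 3%:Z.
  by have := divn_eq (b * c) 4; rewrite r4; clear; lia.
rewrite uE1 uE2 uE3 uE4 pE qE rE in AE.
move: ((a * b) %/ 4)%N ((a * c) %/ 4)%N ((b * c) %/ 4)%N AE => p' q' r' AE.
case: uP1 uP2 uP3 uP4 => -[j1 [h1 E1]] [[j2 [h2 E2]]|[j2 [h2 E2]]]
   [[j3 [h3 E3]]|[j3 [h3 E3]]] [[j4 [h4 E4]]|[j4 [h4 E4]]];
  (try by split; [exists (h1 - h2) | exists (h3 - h4)]; rewrite ?E1 ?E2 ?E3 ?E4; clear; ring);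
  exfalso; rewrite j1 j2 j3 j4 in AE; rewrite E1 E2 E3 E4 in hE;
  move: AE hE; clear; lia.
Qed.

End IntegerParity.

Section GoldenTwist.

Variables (R : realType) (K : fieldExtType rat).
Variables (t : nat) (e1 e2 e3 : K).
Hypothesis F : frame 1 5 t e1 e2 e3.
Hypothesis t4 : (t %% 4 = 3)%N.
Implicit Types x y z w : int.

Local Notation P := (Num.sqrt (1 * 5)%:R : R).
Local Notation Q := (Num.sqrt (1 * t)%:R : R).
Local Notation S := (Num.sqrt (5 * t)%:R : R).

(** As t is 3 modulo 4, integers have coordinates with denominator 2 only. *)
Definition half_comb x y z w : K :=
  quarter_comb e1 e2 e3 (2%:Z * x) (2%:Z * y) (2%:Z * z) (2%:Z * w).

Definition golden : K := half_comb 1 1 0 0.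

Definition golden_inv : K := half_comb (-1) 1 0 0.

Lemma golden_in_OK : in_OK golden.
Proof. by apply: (in_OK_quarter2 F (t := 1) (n := -1)). Qed.

Lemma golden_inv_in_OK : in_OK golden_inv.
Proof. by apply: (in_OK_quarter2 F (t := -1) (n := -1)). Qed.

Lemma goldenK : golden * golden_inv = 1.
Proof.
have -> : 1 = lincomb e1 e2 e3 1 0 0 0 by rewrite /lincomb scale1r !scale0r !addr0.
rewrite /golden /golden_inv /half_comb /quarter_comb (lincombM F).
by congr (lincomb e1 e2 e3 _ _ _ _); field.
Qed.

Lemma golden_neq0 : golden != 0.
Proof. by apply/eqP => g0; have := goldenK; rewrite g0 mul0r => /esym/eqP; rewrite oner_eq0. Qed.

(* Multiplication by the golden ratio, of mixed signature, carries the elements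
   having the sign of the square root of 5 everywhere to the totally positive
   ones. *)
Definition twisted_pos x y z w : Prop :=
  [/\ 0 < y%:~R * P + x%:~R + (z%:~R * Q + w%:~R * S),
      0 < y%:~R * P + x%:~R - (z%:~R * Q + w%:~R * S),
      0 < y%:~R * P - x%:~R + (z%:~R * Q - w%:~R * S)
    & 0 < y%:~R * P - x%:~R - (z%:~R * Q - w%:~R * S)].

Lemma sqrt5_gt1 : 1 < P.
Proof. by rewrite -[X in X < _]sqrtr1 ltr_sqrt ?ltr1n ?ltr0n. Qed.

Lemma half_comb_twisted_pos x y z w :
  totally_positive R (golden * half_comb x y z w) <-> twisted_pos x y z w.
Proof.
have [s [sP sE]] := frame_full_embeddings R F.
have half4 (u : int) : ratr ((2%:Z * u)%:~R / 4%:R) = u%:~R / 2%:R :> R.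
  by rewrite ratr_quarter intrM -pmulrn; field.
have E (x' y' z' w' : int) := real_combE R 1 5 t ((2%:Z * x')%:~R / 4%:R)
  ((2%:Z * y')%:~R / 4%:R) ((2%:Z * z')%:~R / 4%:R) ((2%:Z * w')%:~R / 4%:R).
have [G1 G2 G3 G4] := E 1 1 0 0; have [E1 E2 E3 E4] := E x y z w.
rewrite !half4 in G1 G2 G3 G4 E1 E2 E3 E4.
have gp : 0 < (1 + P) / 2%:R by have := sqrt5_gt1; move: P => P1 *; lra.
have gn : (1 - P) / 2%:R < 0 by have := sqrt5_gt1; move: P => P1 *; lra.
have e i : s i (golden * half_comb x y z w) =
    (if i.1 then (1 - P) / 2%:R else (1 + P) / 2%:R) *
    real_comb R 1 5 t i ((2%:Z * x)%:~R / 4%:R) ((2%:Z * y)%:~R / 4%:R)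
      ((2%:Z * z)%:~R / 4%:R) ((2%:Z * w)%:~R / 4%:R).
  rewrite rmorphM -sE; congr (_ * _); rewrite /golden /half_comb /quarter_comb sE.
  case: i => -[] [] /=; rewrite ?G1 ?G2 ?G3 ?G4; move: P Q S {G1 G2 G3 G4 E1 E2 E3 E4 E gp gn} => P1 Q1 S1; lra.
split=> [p|[p1 p2 p3 p4]].
  have := p (s (false, false)); have := p (s (false, true)).
  have := p (s (true, false)); have := p (s (true, true)).
  rewrite !e /= !(pmulr_rgt0 _ gp) !(nmulr_rgt0 _ gn) E1 E2 E3 E4 /twisted_pos.
  by move: P Q S {G1 G2 G3 G4 E1 E2 E3 E4 E e gp gn p} => P1 Q1 S1 *; split; lra.
apply: (full_embeddings_pos sP) => -[[] []]; rewrite e /= ?(pmulr_rgt0 _ gp) ?(nmulr_rgt0 _ gn).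
all: rewrite ?E1 ?E2 ?E3 ?E4; move: P Q S p1 p2 p3 p4 {G1 G2 G3 G4 E1 E2 E3 E4 E e gp gn} => P1 Q1 S1 *; lra.
Qed.

Lemma twisted_pos_bounds x y z w : twisted_pos x y z w ->
  [/\ 0 < y, z ^+ 2 * t%:Z < 5%:Z * y ^+ 2 & w ^+ 2 * t%:Z < y ^+ 2].
Proof.
rewrite /twisted_pos => -[p1 p2 p3 p4].
have P_gt1 := sqrt5_gt1.
have yP0 : 0 < y%:~R * P by move: P Q S p1 p2 p3 p4 => P1 Q1 S1 *; lra.
have y0 : 0 < y by move: yP0; rewrite pmulr_lgt0 ?ltr0z // (lt_trans ltr01).
have sq (u : int) (n : nat) : `|u%:~R * Num.sqrt n%:R| < y%:~R * P ->
    u ^+ 2 * n%:Z < 5%:Z * y ^+ 2.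
  rewrite -ltr_sqr ?nnegrE ?normr_ge0 ?(ltW yP0) // real_normK ?num_real //.
  rewrite !exprMn !sqr_sqrtn -(ltr_int R) !(rmorphXn, intrM) /= -!pmulrn mul1n.
  by rewrite [_ * 5%:R]mulrC.
split=> //.
  rewrite -[t in t%:Z]mul1n; apply: sq; rewrite ltr_norml; apply/andP.
  by move: P Q S p1 p2 p3 p4 => P1 Q1 S1 *; split; lra.
have : w ^+ 2 * (5 * t)%N%:Z < 5%:Z * y ^+ 2.
  apply: sq; rewrite ltr_norml; apply/andP.
  by move: P Q S p1 p2 p3 p4 => P1 Q1 S1 *; split; lra.
by rewrite PoszM; clear; lia.
Qed.

Lemma twisted_decomposition x y z w (u v : K) :
  in_OKplus R u -> in_OKplus R v -> golden * half_comb x y z w = u + v ->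
  exists x1 y1 z1 w1 x2 y2 z2 w2,
  [/\ [/\ x = x1 + x2, y = y1 + y2, z = z1 + z2 & w = w1 + w2],
      twisted_pos x1 y1 z1 w1, twisted_pos x2 y2 z2 w2,
      (exists h : int, x1 - y1 = 2%:Z * h) /\ (exists h : int, z1 - w1 = 2%:Z * h)
    & (exists h : int, x2 - y2 = 2%:Z * h) /\ (exists h : int, z2 - w2 = 2%:Z * h)].
Proof.
have p4 : ((1 * 5) %% 4 = 1)%N by [].
have q4 : ((1 * t) %% 4 = 3)%N by rewrite mul1n.
have r4 : ((5 * t) %% 4 = 3)%N by move: t4; clear; lia.
have coords u' : in_OKplus R u' -> exists x1 y1 z1 w1,
    [/\ u' = golden * half_comb x1 y1 z1 w1, twisted_pos x1 y1 z1 w1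
      & (exists h : int, x1 - y1 = 2%:Z * h) /\ (exists h : int, z1 - w1 = 2%:Z * h)].
  case=> uO up; have vO : in_OK (golden_inv * u') := in_OKM golden_inv_in_OK uO.
  have [X [Y [Z [W [vE m1 m2 m3]]]]] := in_OK_quarter R F vO.
  have nq : ((1 * t) %% 4 <> 1)%N by rewrite q4.
  have [[x1 XE] [z1 ZE]] := norm_mod4_even (frame_sqf13 F) m2 (or_introl nq).
  have [_ [y1 YE]] := norm_mod4_even (frame_sqf12 F) m1 (or_intror (ex_intro _ x1 XE)).
  have [_ [w1 WE]] := norm_mod4_even (frame_sqf23 F) m3 (or_intror (ex_intro _ x1 XE)).
  have uE : u' = golden * half_comb x1 y1 z1 w1.
    by rewrite /half_comb -XE -YE -ZE -WE -vE mulrA goldenK mul1r.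
  exists x1, y1, z1, w1; split=> //; first by apply/half_comb_twisted_pos; rewrite -uE.
  by apply: (half_coords_parity R F p4 q4 r4); rewrite -XE -YE -ZE -WE -vE.
move=> /coords[x1 [y1 [z1 [w1 [-> p1 h1]]]]] /coords[x2 [y2 [z2 [w2 [-> p2 h2]]]]].
rewrite -mulrDr => /(mulfI golden_neq0); rewrite /half_comb quarter_combD -!mulrDr.
move=> /(quarter_comb_inj F)[Ex Ey Ez Ew].
exists x1, y1, z1, w1, x2, y2, z2, w2; split=> //.
by split; [move: Ex | move: Ey | move: Ez | move: Ew]; clear; lia.
Qed.

(** The counterpart of [codifferent_pos] in the twisted cone: there z^2 t < 5 y^2, and 5 k^2 < t
    then gives k z < y. *)
Lemma twisted_functional_pos (k : nat) x y z w :
  (5 * k ^ 2 < t)%N -> twisted_pos x y z w -> 1 <= y - k%:Z * z.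
Proof.
move=> kt /twisted_pos_bounds[y0 bz _].
suff : 0 < y - k%:Z * z by clear; lia.
rewrite subr_gt0; have [z0|z0] := leP z 0; first by apply: le_lt_trans y0; rewrite mulr_ge0_le0.
rewrite -ltr_sqr ?nnegrE ?(ltW y0) ?mulr_ge0 ?(ltW z0) // exprMn.
have : z ^+ 2 * (5 * k ^ 2)%N%:Z <= z ^+ 2 * t%:Z by rewrite ler_wpM2l ?sqr_ge0 // lez_nat ltnW.
have : k%:Z ^+ 2 = (k ^ 2)%N%:Z by rewrite expr2 -PoszM mulnn.
by move=> ->; rewrite PoszM; move: bz; clear; lia.
Qed.

End GoldenTwist.

Lemma scaled_sqrt_bracket (d t : nat) : (0 < d)%N -> (0 < t)%N ->
  exists k : nat, (d * k ^ 2 < t <= d * k.+1 ^ 2)%N.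
Proof.
move=> d0 t0; have ex : exists k, (t <= d * k ^ 2)%N by exists t; nia.
case: (ex_minnP ex) => -[|k] tk min; first by move: tk; rewrite muln0; lia.
by exists k; rewrite tk andbT ltnNge; apply/negP => /min; rewrite ltnn.
Qed.

Section GoldenForm.

Variables (R : realType) (K : fieldExtType rat).
Variables (t : nat) (e1 e2 e3 : K).
Hypothesis F : frame 1 5 t e1 e2 e3.
Hypothesis t4 : (t %% 4 = 3)%N.

Local Notation P := (Num.sqrt (1 * 5)%:R : R).
Local Notation Q := (Num.sqrt (1 * t)%:R : R).
Local Notation hc := (half_comb e1 e2 e3).
Local Notation golden := (golden e1 e2 e3).
Local Notation golden_inv := (golden_inv e1 e2 e3).

Lemma half_comb_sqrt_in_OK (j : int) : in_OK (hc 0 (2%:Z * j) 2%:Z 0).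
Proof.
have e2O : in_OK e2.
  by apply: (@in_OK_quadratic _ _ 0 (- (1 * t)%N%:Z)); rewrite (frame_e22 F) mul0r sub0r rmorphN opprK.
have e1O : in_OK (quarter_comb e1 e2 e3 (2%:Z * 0) (2%:Z * (2%:Z * j)) 0 0).
  by apply: (in_OK_quarter2 F (n := - 5%:Z * j ^+ 2)); ring.
suff -> : hc 0 (2%:Z * j) 2%:Z 0 = quarter_comb e1 e2 e3 (2%:Z * 0) (2%:Z * (2%:Z * j)) 0 0 + e2.
  exact: in_OKD.
have e2E : quarter_comb e1 e2 e3 0 0 4%:Z 0 = e2.
  by rewrite /quarter_comb /lincomb mul0r !scale0r !add0r divff ?scale1r ?addr0.
by rewrite -[X in _ + X]e2E quarter_combD /half_comb; congr (quarter_comb e1 e2 e3 _ _ _ _); ring.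
Qed.

Lemma half_comb_sub_golden (j : int) :
  hc 1 (2%:Z * j + 1) 2%:Z 0 = hc 0 (2%:Z * (j + 1)) 2%:Z 0 - golden_inv.
Proof.
apply/eqP; rewrite eq_sym subr_eq /half_comb /golden_inv /half_comb quarter_combD.
by apply/eqP; congr (quarter_comb e1 e2 e3 _ _ _ _); ring.
Qed.

Lemma golden_mul_inv_not_integer (v : K) :
  ~ in_OK v^-1 -> ~ in_OK (golden * v)^-1.
Proof.
move=> vN gO; apply: vN; have := in_OKM (golden_in_OK F) gO.
by rewrite invfM mulVKf // (golden_neq0 F).
Qed.

(** There are two candidates. On (1 + (2 k + 1) sqrt 5)/2 + sqrt t the functional y - k z is 1, so
    this element cannot split if it lies in the twisted cone. Otherwise (k + 1) sqrt 5 + sqrt t, of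
    value 2, could only split into two elements of value 1, one of which would force the first
    candidate into the cone. *)
Lemma golden_form (N : nat) : (t.+1 = N ^ 2)%N ->
  exists q : 'M[K]_2, additively_indecomposable R q.
Proof.
move=> tN.
have t0 : (0 < t)%N by move: t4; clear; case: t.
have [k /andP[kt tk]] := scaled_sqrt_bracket (isT : (0 < 5)%N) t0.
have Ne : ~~ odd N.
  apply/negP => No; have [l lE] : exists l : nat, N = (2 * l).+1.
    by exists N./2; move: No; clear; lia.
  by move: t4 tN; rewrite lE -mulnn; clear; lia.
have N0 : (0 < N)%N by move: tN; clear; case: N.
have [t' tE] : exists t' : nat, t = (4 * t' + 3)%N.
  by exists (t %/ 4)%N; have := divn_eq t 4; rewrite t4; clear; lia.
have [s [sP _]] := frame_full_embeddings R F.
have N2 : N%:Z ^+ 2 = t%:Z + 1 by rewrite expr2 -PoszM mulnn -tN -addn1 PoszD.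
have tR : t%:R = N%:R ^+ 2 - 1 :> rat by rewrite -natrX -tN -natr1 addrK.
have P0 := sqrt5_gt1 R.
have sqP : P ^+ 2 = 5%:R by rewrite sqr_sqrtn.
have sqQ : Q ^+ 2 = t%:R by rewrite sqr_sqrtn mul1n.
have Q0 : 0 <= Q := sqrtr_ge0 _.
(* The sign condition for the first candidate at its worst place. *)
case: (boolP (0 < (2%:Z * k%:Z + 1)%:~R * P - 1 - 2%:R * Q)) => [pos|npos].
  have tw : twisted_pos R t 1 (2%:Z * k%:Z + 1) 2%:Z 0.
    rewrite /twisted_pos !mul0r -[(2%:Z)%:~R]pmulrn.
    by move: P Q pos P0 Q0 {sqP sqQ} => P1 Q1 pos P0 Q0; split; lra.
  have vO : in_OK (hc 1 (2%:Z * k%:Z + 1) 2%:Z 0).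
    rewrite half_comb_sub_golden; apply: in_OKB; first exact: half_comb_sqrt_in_OK.
    exact: (golden_inv_in_OK F).
  apply: (indecomposable_form_of_integer (false, false) sP
           (a := golden * hc 1 (2%:Z * k%:Z + 1) 2%:Z 0)).
    split; first by split; [apply: in_OKM (golden_in_OK F) vO | apply/(half_comb_twisted_pos R F)].
    move=> u v uO vO' E.
    have [x1 [y1 [z1 [w1 [x2 [y2 [z2 [w2 [[_ Ey Ez _] p1 p2 _ _]]]]]]]]] :=
      twisted_decomposition F t4 uO vO' E.
    have := twisted_functional_pos kt p1; have := twisted_functional_pos kt p2.
    have -> : z2 = 2%:Z - z1 by move: Ez; clear; lia.
    by move: Ey; clear; lia.
  apply: golden_mul_inv_not_integer.
  (* The relative norm to Q(sqrt 5) is h + 1/2 + (k + 1/2) sqrt 5, whose norm is h^2 + 1 - N^2. *)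
  pose h : int := 5%:Z * (k%:Z ^+ 2 + k%:Z) + 2%:Z - N%:Z ^+ 2.
  apply: (nonunit_of_norm R F erefl vO (n := h ^+ 2 + 1 - N%:Z ^+ 2)).
    rewrite /absnorm /relnorm_rat /relnorm_irr /h !(intrB, intrD) !(rmorphXn, intrM) /=.
    by rewrite !(intrB, intrD) !(rmorphXn, intrM) /= -!pmulrn !mul1n natrM tR; field.
  have h0 : 0 <= h.
    have pos5 : 0 < 5%:Z * (2%:Z * k%:Z + 1) ^+ 2 + 1 - 4%:Z * t%:Z.
      rewrite -(ltr_int R) intrB intrD intrM rmorphXn /= [(4%:Z * _)%:~R]intrM.
      move: pos; set f := (2%:Z * k%:Z + 1)%:~R => pos; rewrite -!pmulrn.
      have fP2 : (f * P) ^+ 2 = 5%:R * f ^+ 2 by rewrite exprMn sqP mulrC.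
      have : (1 + 2%:R * Q) ^+ 2 < (f * P) ^+ 2.
        move: Q0 pos; move: (f * P) Q {fP2 sqQ} => u1 Q1 Q0 pos.
        by rewrite ltr_sqr ?nnegrE; lra.
      rewrite fP2 -sqQ; move: Q f Q0 {pos fP2 sqQ} => Q1 f1 Q0 lt; lra.
    by rewrite /h; move: pos5 N2; clear; lia.
  have [v [i vE vP]] := sqr_mod4 h.
  (* As N^2 = t + 1 is 0 modulo 4, the norm is 1 or 2 modulo 4. *)
  have n0 : h ^+ 2 + 1 - N%:Z ^+ 2 <> 0.
    by rewrite vE N2 tE PoszD PoszM; case: vP => -[-> _]; clear; lia.
  have nN1 : h ^+ 2 + 1 - N%:Z ^+ 2 <> -1.
    by rewrite vE N2 tE PoszD PoszM; case: vP => -[-> _]; clear; lia.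
  (* Norm 1 means h = N, that is (2 N - 1)(2 N + 3) = 5 (2 k + 1)^2. *)
  have n1 : h ^+ 2 + 1 - N%:Z ^+ 2 <> 1.
    move=> E; have /eqP : h ^+ 2 = N%:Z ^+ 2 by move: E; clear; lia.
    rewrite eqf_sqr => /orP[] /eqP hN; last by move: h0 N0; rewrite hN; clear; lia.
    apply: (@five_squares N (2 * k + 1) Ne N0).
    move: hN N0; rewrite /h -!mulnn !expr2; clear; case: N => // M; clear.
    have -> : (2 * M.+1 - 1 = 2 * M + 1)%N by lia.
    by lia.
  by move: n0 nN1 n1; clear; lia.
(* If z = 1, then w is odd and t < (k + 1)^2, against 5 k^2 < t. If z < 0, then k = 0, y = 1 and w =
   0, and z is even, too large for the bound. *)
have no_small x y z w : twisted_pos R t x y z w -> y = 1 + k%:Z * z ->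
    (exists h : int, z - w = 2%:Z * h) -> 0 <= z /\ z <> 1.
  move=> /twisted_pos_bounds[y0 bz bw] yE [h zw].
  have w_ge1 : w <> 0 -> 1 <= w ^+ 2.
    by move=> w0; have : w ^+ 2 != 0 by [rewrite sqrf_eq0; apply/eqP];
       have := sqr_ge0 w; clear; lia.
  have w_lt : w <> 0 -> t%:Z < y ^+ 2.
    move=> /w_ge1 w1; apply: le_lt_trans bw; rewrite -[X in X <= _]mul1r.
    by rewrite ler_wpM2r.
  split.
    rewrite leNgt; apply/negP => z0.
    have k0 : k = 0%N.
      have : k%:Z * z <= k%:Z * -1 by rewrite ler_wpM2l //; move: z0; clear; lia.
      by move: y0; rewrite yE; clear; lia.
    have y1 : y = 1 by rewrite yE k0 mul0r addr0.
    have w0 : w = 0.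
      by apply/eqP/negPn/negP => /eqP/w_lt; rewrite y1; move: t0; clear; lia.
    have zh : z = 2%:Z * h by move: zw; rewrite w0 subr0.
    have h1 : 1 <= h ^+ 2.
      have : h ^+ 2 != 0 by rewrite sqrf_eq0; apply/eqP; move: z0; rewrite zh; clear; lia.
      by have := sqr_ge0 h; clear; lia.
    have : 1 * t%:Z <= h ^+ 2 * t%:Z by rewrite ler_wpM2r.
    by move: bz; rewrite zh y1 exprMn tE; clear; lia.
  move=> z1; have : t%:Z < y ^+ 2.
    by apply: w_lt => w0; move: zw; rewrite z1 w0; clear; lia.
  by rewrite yE z1; move: kt; rewrite -mulnn; clear; nia.
(* Here w = 0 and x is odd, so |x| >= 1 and positivity would imply the sign condition that the first
   candidate fails. *)
have no_two x y z w : twisted_pos R t x y z w -> y = 1 + k%:Z * z -> z = 2%:Z ->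
    (exists h : int, x - y = 2%:Z * h) -> (exists h : int, z - w = 2%:Z * h) -> False.
  move=> tw yE z2 [h xy] [h' zw]; have [y0 _ bw] := twisted_pos_bounds tw.
  have w0 : w = 0.
    have wE : w = 2%:Z * (1 - h') by move: zw; rewrite z2; clear; lia.
    rewrite wE; have [->|h'1] := eqVneq (1 - h') 0; first by rewrite mulr0.
    have h1 : 1 <= (1 - h') ^+ 2.
      by move: h'1; rewrite -sqrf_eq0; have := sqr_ge0 (1 - h'); clear; lia.
    have : 1 * t%:Z <= (1 - h') ^+ 2 * t%:Z by rewrite ler_wpM2r.
    by move: bw kt; rewrite wE exprMn yE z2 -mulnn; clear; nia.
  have yk : y = 2%:Z * k%:Z + 1 by rewrite yE z2; clear; lia.
  move: tw; rewrite /twisted_pos w0 z2 mul0r addr0 subr0 -[(2%:Z)%:~R]pmulrn yk => -[_ p2 _ p4].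
  case/negP: npos.
  have [x1|x1] : x <= -1 \/ 1 <= x by move: xy; rewrite yk; clear; lia.
    have : x%:~R <= (-1)%:~R :> R by rewrite ler_int.
    by move: P Q p2 {p4 P0 Q0 sqP sqQ} => P1 Q1 p2 *; lra.
  have : (1 : int)%:~R <= x%:~R :> R by rewrite ler_int.
  by move: P Q p4 {p2 P0 Q0 sqP sqQ} => P1 Q1 p4 *; lra.
(* Five times a square is 0 or 1 modulo 4. *)
have t5 : (t <> 5 * k.+1 ^ 2)%N.
  have [l [i lE lP]] := sqr_mod4 k.+1%:Z.
  have E2 : k.+1%:Z ^+ 2 = (k.+1 ^ 2)%N%:Z by rewrite expr2 -PoszM mulnn.
  by rewrite tE; rewrite E2 in lE; case: lP lE => -[-> _]; clear; lia.
have {}tk : (t < 5 * k.+1 ^ 2)%N by move: t5 tk; clear; lia.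
have tw : twisted_pos R t 0 (2%:Z * (k%:Z + 1)) 2%:Z 0.
  have lt : 2%:R * Q < 2%:R * (k.+1%:R * P).
    rewrite ltr_pM2l ?ltr0n // -ltr_sqr ?nnegrE ?mulr_ge0 ?ler0n ?sqrtr_ge0 //.
    by rewrite exprMn sqP sqQ -natrX -natrM ltr_nat mulnC.
  rewrite /twisted_pos mul0r intrM intrD -!pmulrn natr1.
  by move: P Q lt Q0 {sqP sqQ npos P0} => P1 Q1 lt Q0; split; lra.
have vO := half_comb_sqrt_in_OK (k%:Z + 1).
apply: (indecomposable_form_of_integer (false, false) sP
         (a := golden * hc 0 (2%:Z * (k%:Z + 1)) 2%:Z 0)).
  split; first by split; [apply: in_OKM (golden_in_OK F) vO | apply/(half_comb_twisted_pos R F)].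
  move=> y z yO zO E.
  have [x1 [y1 [z1 [w1 [x2 [y2 [z2 [w2 [[_ Ey Ez _] p1 p2 h1 h2]]]]]]]]] :=
    twisted_decomposition F t4 yO zO E.
  have f1 := twisted_functional_pos kt p1; have f2 := twisted_functional_pos kt p2.
  have z2E : z2 = 2%:Z - z1 by move: Ez; clear; lia.
  have y1E : y1 = 1 + k%:Z * z1 by move: f1 f2 Ey; rewrite z2E; clear; lia.
  have y2E : y2 = 1 + k%:Z * z2 by move: f1 f2 Ey; rewrite z2E; clear; lia.
  have [[z10 z11] [z20 z21]] := (no_small _ _ _ _ p1 y1E h1.2, no_small _ _ _ _ p2 y2E h2.2).
  have [z1E|z1E] : z1 = 2%:Z \/ z2 = 2%:Z.
    by move: z10 z11 z20 z21 z2E; clear; lia.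
  - exact: no_two p1 y1E z1E h1.1 h1.2.
  - exact: no_two p2 y2E z1E h2.1 h2.2.
apply: golden_mul_inv_not_integer.
pose D : int := 5%:Z * k.+1%:Z ^+ 2 - t%:Z.
apply: (nonunit_of_norm R F erefl vO (n := D ^+ 2)).
  rewrite /absnorm /relnorm_rat /relnorm_irr /D !(rmorphXn, intrB, intrM, intrD) /=.
  by rewrite -!pmulrn -[k.+1]addn1 natrD !mul1n; field.
have E2 : k.+1%:Z ^+ 2 = (k.+1 ^ 2)%N%:Z by rewrite expr2 -PoszM mulnn.
have D1 : D <> 1.
  rewrite /D => D1; have E : (N ^ 2 = 5 * k.+1 ^ 2)%N.
    by rewrite -tN; move: D1 tk; rewrite E2; clear; lia.
  have : (k.+1%:R : rat) = 0.
    apply: (@squarefree_irrational (1 * 5) N%:R _ (frame_sqf12 F)) => //.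
    by rewrite -!natrX -natrM mul1n E.
  by move/eqP; rewrite pnatr_eq0.
have D0 : 0 < D by rewrite /D E2; move: tk; clear; lia.
by rewrite abszX; move: D D0 D1; clear => D D0 D1; nia.
Qed.

End GoldenForm.

(** * Choice of the radicand, by residues modulo 4 *)

Lemma squarefree_neq_square (n k : nat) : squarefree n -> (1 < n)%N -> n <> (k ^ 2)%N.
Proof.
move=> nsq n1 nk; have k1 : k = 1%N by apply: nsq; rewrite nk.
by move: n1; rewrite nk k1.
Qed.

Lemma squarefree_bracket (n : nat) : squarefree n -> (1 < n)%N ->
  exists k : nat, (k ^ 2 < n < k.+1 ^ 2)%N.
Proof.
move=> nsq n1; have [k /andP[kn nk]] := scaled_sqrt_bracket (isT : (0 < 1)%N) (ltnW n1).
rewrite mul1n in kn; rewrite mul1n in nk; exists k; rewrite kn /= ltn_neqAle nk andbT.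
exact/eqP/squarefree_neq_square.
Qed.

Lemma squarefree_odd_bracket (n : nat) : squarefree n -> (1 < n)%N -> (n %% 4 = 1)%N ->
  exists2 j : nat, odd j & (j ^ 2 < n < j.+2 ^ 2)%N.
Proof.
move=> nsq n1 n4; have [k /andP[kn nk]] := squarefree_bracket nsq n1.
have n5 : (5 <= n)%N by lia.
have [ko|ke] := boolP (odd k).
  by exists k; rewrite ?kn //=; apply: ltn_trans nk _; rewrite ltn_exp2r.
case: k ke kn nk => [|k]; first by move=> _ _; lia.
rewrite /= negbK => ko kn nk; exists k; rewrite // nk andbT.
by apply: ltn_trans kn; rewrite ltn_exp2r.
Qed.

Section FrameCases.

Variables (R : realType) (K : fieldExtType rat).

(** If both were small, a (c - b) < 2 k would give a < k, hence b > k and b c >= (k + 1)^2. *)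
Lemma two_congruent_arith (a b c k : nat) : (b + 2 <= c)%N -> (k ^ 2 < a * b)%N ->
  ~~ ((a * c < k.+1 ^ 2)%N && (b * c < k.+1 ^ 2)%N).
Proof.
move=> bc kab; apply/negP => /andP[h1 h2].
have ak : (a < k)%N by rewrite -!mulnn in kab h1 h2; nia.
have kb : (k < b)%N.
  rewrite ltnNge; apply/negP => bk; have : (a * b <= k * k)%N by apply: leq_mul => //; apply: ltnW.
  by rewrite mulnn leqNgt kab.
have : (k.+1 * k.+1 <= b * c)%N by apply: leq_mul => //; lia.
by rewrite mulnn leqNgt h2.
Qed.

(** Odd a < b < c give c >= a + 4, and b > j, so b c >= a b + 4 b exceeds (j + 2)^2. *)
Lemma three_odd_arith (a b c j : nat) : (a < b < c)%N -> odd a -> odd b -> odd c ->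
  (j ^ 2 < a * b)%N -> (b * c < j.+2 ^ 2)%N -> False.
Proof.
move=> /andP[ab bc] ao bo co jab bcj.
have jb : (j < b)%N.
  rewrite ltnNge; apply/negP => bj.
  have : (a * b <= j * j)%N by apply: leq_mul => //; lia.
  by rewrite mulnn leqNgt jab.
have ca : (a + 4 <= c)%N by lia.
have : (b * (a + 4) <= b * c)%N by rewrite leq_mul2l ca orbT.
by rewrite -!mulnn in jab bcj; rewrite mulnDr; nia.
Qed.

(** For b < c the congruence gives c >= b + 2, so ab serves unless ab + 1 is a square. In that case
    ab is 3 and bc is 1 modulo 4, and one turns to bc. *)
Lemma frame_congruent_form (a b c : nat) (e1 e2 e3 : K) :
  frame a b c e1 e2 e3 -> ((a * b) %% 4 = (a * c) %% 4)%N -> ((a * b) %% 4 <> 1)%N ->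
  exists q : 'M[K]_2, additively_indecomposable R q.
Proof.
wlog bc : b c e1 e2 / (b < c)%N => [wl|].
  move=> F E n1; case: (ltngtP b c) => [lt|lt|eq].
  - exact: wl lt F E n1.
  - by apply: wl lt (frame_swap23 F) (esym E) _; rewrite -E.
  - by case: (frame_neq23 F).
move=> F E n1; have [a0 b0 c0] := frame_gt0 F.
have p_sq := frame_sqf12 F; have q_sq := frame_sqf13 F; have r_sq := frame_sqf23 F.
have p_gt1 := frame_gt1 F.
have p4 := squarefree_mod4 p_sq; have q4 := squarefree_mod4 q_sq.
have r4 := squarefree_mod4 r_sq.
have mods : (a %% 4 < 4 /\ b %% 4 < 4 /\ c %% 4 < 4)%N by rewrite !ltn_mod.
have bc2 : (b + 2 <= c)%N.
  suff : odd b = odd c by move: bc; clear; lia.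
  rewrite -(odd_mod b (erefl : odd 4 = false)) -(odd_mod c (erefl : odd 4 = false)).
  move: E n1 p4 q4 r4 mods; rewrite -!(modnMm a b) -!(modnMm a c) -!(modnMm b c); clear.
  case: (a %% 4)%N => [|[|[|[|a']]]]; case: (b %% 4)%N => [|[|[|[|b']]]];
  case: (c %% 4)%N => [|[|[|[|c']]]] //=; by move=> *; lia.
have [k /andP[kp pk]] := squarefree_bracket p_sq p_gt1.
have := two_congruent_arith bc2 kp => small.
have [unit|nunit] := eqVneq (a * b).+1 (k.+1 ^ 2)%N; last first.
  by apply: (root_form R F n1 (k := k)) => //; [rewrite kp pk | apply/eqP].
have p3 : ((a * b) %% 4 = 3)%N.
  have [l [i lE lP]] := sqr_mod4 k.+1%:Z.
  have E2 : k.+1%:Z ^+ 2 = (k.+1 ^ 2)%N%:Z by rewrite expr2 -PoszM mulnn.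
  rewrite E2 -unit in lE; move: n1 p4; clear -lE lP.
  by case: lP lE => -[-> _]; lia.
have r1 : ((b * c) %% 4 = 1)%N.
  move: E p3 mods; rewrite -!(modnMm a b) -!(modnMm a c) -!(modnMm b c); clear.
  case: (a %% 4)%N => [|[|[|[|a']]]]; case: (b %% 4)%N => [|[|[|[|b']]]];
  case: (c %% 4)%N => [|[|[|[|c']]]] //=; by move=> *; lia.
have F3 := frame_swap23 (frame_swap12 F).
have [j jo jr] := squarefree_odd_bracket r_sq (frame_gt1 F3) r1.
have [r_unit|r_nunit] := eqVneq (b * c + 4)%N (j.+2 ^ 2)%N; last first.
  apply: (half_root_form R F3 jo r1 jr); first exact/eqP.
  by rewrite mulnC p3.
have rj : (b * c = j * (j + 4))%N.
  by move: r_unit; rewrite -mulnn; clear; lia.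
have [j1|j1] := leqP j 1.
  have {}j1 : j = 1%N by move: jo j1; case: j {jr r_unit rj} => [|[]].
  have /andP[/eqP b1 /eqP c5] : (b == 1) && (c == 5)%N.
    rewrite j1 in rj; have : (b <= 2)%N by move: rj bc; clear; nia.
    by move: rj bc b0; clear; case: b => [|[|[|]]] //; lia.
  rewrite b1 c5 in F3; have a3 : (a %% 4 = 3)%N by move: p3; rewrite b1 muln1.
  by apply: (golden_form R F3 a3 (N := k.+1)); rewrite -unit b1 muln1.
have [ab_j|ab_j] := eqVneq (a * b)%N j; last first.
  apply: (half_unit_form R F3 jo rj j1); rewrite [(b * a)%N]mulnC [(c * a)%N]mulnC.
    by case=> /eqP; rewrite (negbTE ab_j).
  case=> ab ac; have : (a * b < a * c)%N by rewrite ltn_mul2l a0 bc.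
  by rewrite ab ac; clear; lia.
have [ac_j|ac_j] := eqVneq (a * c)%N (j + 4)%N; last first.
  apply: (half_unit_form R F3 jo rj j1); rewrite [(b * a)%N]mulnC [(c * a)%N]mulnC.
    by case=> _ /eqP; rewrite (negbTE ac_j).
  by case=> E1; move: ab_j; rewrite E1; clear; lia.
(* What remains is ab = j, ac = j + 4, where the unit over bc is a square. Then ac = (k + 1)^2 + 3
   lies strictly between consecutive squares and is not one less than a square, so ac serves. *)
have k1 : (1 <= k)%N by move: pk p_gt1; clear; case: k => //; lia.
have jk : (j.+1 = k.+1 ^ 2)%N by rewrite -unit ab_j.
have qk : (k.+1 ^ 2 < a * c < k.+2 ^ 2)%N.
  by rewrite ac_j; move: jk k1; rewrite -!mulnn; clear; lia.
apply: (root_form R (frame_swap23 F) _ qk).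
- by rewrite -E.
- by rewrite ac_j; move: jk k1; rewrite -!mulnn; clear; lia.
- rewrite negb_and -!leqNgt; apply/orP; right.
  by rewrite mulnC rj; move: jk k1; rewrite -!mulnn; clear; nia.
Qed.

(** The product bc is too large to permit a splitting over ab. Of the units over ab, only that for
    ab = 5 is not settled by [half_unit_form]; then ac = c is used, 5 c being too large. *)
Lemma frame_odd_form (a b c : nat) (e1 e2 e3 : K) :
  frame a b c e1 e2 e3 -> (a < b < c)%N ->
  ((a * b) %% 4 = 1)%N -> ((a * c) %% 4 = 1)%N -> ((b * c) %% 4 = 1)%N ->
  exists q : 'M[K]_2, additively_indecomposable R q.
Proof.
move=> F abc p1 q1 r1; have [a0 b0 c0] := frame_gt0 F.
have [j jo jp] := squarefree_odd_bracket (frame_sqf12 F) (frame_gt1 F) p1.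
have /andP[ab bc] := abc; have /andP[jp1 jp2] := jp.
have odds x y : ((x * y) %% 4 = 1)%N -> odd x && odd y.
  by move=> xy; rewrite -oddM; move: xy; clear; lia.
have /andP[ao bo] := odds _ _ p1; have /andP[_ co] := odds _ _ q1.
have [p_unit|p_nunit] := eqVneq (a * b + 4)%N (j.+2 ^ 2)%N; last first.
  apply: (half_root_form R F jo p1 jp); first exact/eqP.
  apply/negP => /and4P[_ _ _ bcj]; exact: three_odd_arith abc ao bo co jp1 bcj.
have pj : (a * b = j * (j + 4))%N by move: p_unit; rewrite -mulnn; clear; lia.
have [j1|j1] := leqP j 1; last first.
  have : (a * b < a * c)%N by rewrite ltn_mul2l a0 bc.
  by move=> lt; apply: (half_unit_form R F jo pj j1); move: lt j1; rewrite pj; clear; nia.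
have {}j1 : j = 1%N by move: jo j1; case: j {jp jp1 jp2 p_unit pj} => [|[]].
have /andP[/eqP a1 /eqP b5] : (a == 1) && (b == 5)%N.
  rewrite j1 in pj; have : (a <= 2)%N by move: pj ab; clear; nia.
  by move: pj ab a0; clear; case: a => [|[|[|]]] //; lia.
subst a b; have F2 := frame_swap23 F.
have [i io ip] := squarefree_odd_bracket (frame_sqf12 F2) (frame_gt1 F2) q1.
rewrite mul1n in q1 ip; have /andP[ip1 ip2] := ip.
have [c_unit|c_nunit] := eqVneq (1 * c + 4)%N (i.+2 ^ 2)%N; last first.
  apply: (half_root_form R F2 io); rewrite ?mul1n //; first by rewrite mul1n in c_nunit; apply/eqP.
  apply/negP => /and4P[_ _ _ bcj].
  have ii : (i <= i * i)%N by clear; case: i => // i; rewrite leq_pmulr.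
  by move: ip1 bcj ii; rewrite -!mulnn; clear; lia.
have ci : (1 * c = i * (i + 4))%N by move: c_unit; rewrite -mulnn; clear; lia.
have i1 : (1 < i)%N.
  by move: ci bc; rewrite mul1n; clear; case: i => [|[|]] //; lia.
by apply: (half_unit_form R F2 io ci i1); move: ci i1; rewrite mul1n; clear; nia.
Qed.

Lemma frame_form (a b c : nat) (e1 e2 e3 : K) :
  frame a b c e1 e2 e3 -> exists q : 'M[K]_2, additively_indecomposable R q.
Proof.
move=> F1.
have F2 := frame_swap12 F1; have F3 := frame_swap23 F1.
have F4 := frame_swap23 F2; have F5 := frame_swap12 F3.
have F6 := frame_swap12 F4.
have p4 := squarefree_mod4 (frame_sqf12 F1); have q4 := squarefree_mod4 (frame_sqf13 F1).
have r4 := squarefree_mod4 (frame_sqf23 F1).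
have mods : (a %% 4 < 4 /\ b %% 4 < 4 /\ c %% 4 < 4)%N by rewrite !ltn_mod.
(* At most one of a, b, c is even, and its two products are 2 modulo 4. If all are odd but not
   congruent, the two products with the odd one out are 3 modulo 4. *)
have [all1|[ca|[cb|cc]]] : ((a * b) %% 4 = 1 /\ (a * c) %% 4 = 1 /\ (b * c) %% 4 = 1)%N \/
   ((a * b) %% 4 = (a * c) %% 4 /\ (a * b) %% 4 <> 1)%N \/
   ((b * a) %% 4 = (b * c) %% 4 /\ (b * a) %% 4 <> 1)%N \/
   ((c * a) %% 4 = (c * b) %% 4 /\ (c * a) %% 4 <> 1)%N.
  rewrite [(b * a)%N]mulnC [(c * a)%N]mulnC [(c * b)%N]mulnC.
  move: p4 q4 r4 mods; rewrite -!(modnMm a b) -!(modnMm a c) -!(modnMm b c); clear.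
  case: (a %% 4)%N => [|[|[|[|a']]]]; case: (b %% 4)%N => [|[|[|[|b']]]];
  case: (c %% 4)%N => [|[|[|[|c']]]] //=; by move=> *; lia.
- case: all1 => p1 [q1 r1].
  have [p1' q1' r1'] : [/\ ((b * a) %% 4 = 1)%N, ((c * a) %% 4 = 1)%N & ((c * b) %% 4 = 1)%N].
    by rewrite [(b * a)%N]mulnC [(c * a)%N]mulnC [(c * b)%N]mulnC.
  have ab := frame_neq12 F1; have ac := frame_neq13 F1; have bc := frame_neq23 F1.
  have [h|[h|[h|[h|[h|h]]]]] : (a < b < c \/ b < a < c \/ a < c < b \/ b < c < a
    \/ c < a < b \/ c < b < a)%N by move: ab ac bc; clear; lia.
  + exact: frame_odd_form F1 h _ _ _.
  + exact: frame_odd_form F2 h _ _ _.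
  + exact: frame_odd_form F3 h _ _ _.
  + exact: frame_odd_form F4 h _ _ _.
  + exact: frame_odd_form F5 h _ _ _.
  + exact: frame_odd_form F6 h _ _ _.
- exact: frame_congruent_form F1 ca.1 ca.2.
- exact: frame_congruent_form F2 cb.1 cb.2.
- exact: frame_congruent_form F5 cc.1 cc.2.
Qed.

End FrameCases.

(** * From the generators sqrt p and sqrt q to a symmetric frame *)

Lemma squarefree_dvd (m n : nat) : (m %| n)%N -> squarefree n -> squarefree m.
Proof. by move=> mn nsq d dm; apply: nsq; apply: dvdn_trans mn. Qed.

Lemma squarefree_coprime_mul (m n : nat) :
  coprime m n -> squarefree m -> squarefree n -> squarefree (m * n).
Proof.
move=> cmn msq nsq d dmn; apply/eqP/negPn/negP => d1.
have d0 : (0 < d)%N.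
  case: d dmn d1 => // dmn _; move: dmn; rewrite dvd0n muln_eq0.
  by case/orP=> /eqP E; [have := squarefree_gt0 msq | have := squarefree_gt0 nsq]; rewrite E.
have [p pp pd] : exists2 p, prime p & (p %| d)%N.
  by exists (pdiv d); rewrite ?pdiv_prime ?pdiv_dvd //; case: d d0 d1 {dmn} => [|[]].
have p2 : (p ^ 2 %| m * n)%N by apply: dvdn_trans dmn; apply: dvdn_exp2r.
have p_neq1 : p <> 1%N by move=> p1; move: pp; rewrite p1.
have [pm|pm] := boolP (p %| m)%N.
  have c2 : coprime (p ^ 2) n by rewrite coprimeXl //; apply: coprime_dvdl cmn.
  by move: p2; rewrite Gauss_dvdl // => /msq.
have c2 : coprime (p ^ 2) m by rewrite coprimeXl // prime_coprime.
by move: p2; rewrite Gauss_dvdr // => /nsq.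
Qed.

(** The span is closed under multiplication, and a finite-dimensional subalgebra of a field is a
    subfield. *)
Lemma biquadratic_span (K : fieldExtType rat) (a b c : nat) (e1 e2 e3 : K) :
  frame_relations a b c e1 e2 e3 -> <<1 & [:: e1; e2]>>%VS = fullv ->
  forall v : K, exists x y z w, v = lincomb e1 e2 e3 x y z w.
Proof.
move=> rel full; pose V := span [:: 1; e1; e2; e3].
have memV v : reflect (exists x y z w, v = lincomb e1 e2 e3 x y z w) (v \in V).
  apply: (iffP idP) => [|[x [y [z [w ->]]]]].
    rewrite /V !span_cons span_nil addv0.
    case/memv_addP=> v0 /vlineP[x ->] [v1 /memv_addP[v2 /vlineP[y ->]]] [v3].
    case/memv_addP=> v4 /vlineP[z ->] [v5 /vlineP[w ->] ->] -> ->.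
    by exists x, y, z, w; rewrite /lincomb !addrA.
  have sp u : u \in [:: 1; e1; e2; e3] -> u \in V by apply: memv_span.
  by rewrite !rpredD ?rpredZ // sp ?inE ?eqxx ?orbT.
have V1 : 1 \in V by apply: memv_span; rewrite inE eqxx.
have VM : (V * V <= V)%VS.
  apply/prodvP => u v /memV[x [y [z [w ->]]]] /memV[x' [y' [z' [w' ->]]]].
  apply/memV; rewrite !lincombE (rational_combM _ _ _ _ _ _ _ _ _ rel).
  by do 4 eexists; rewrite lincombE.
have Vasp : is_aspace V by rewrite /is_aspace VM has_algid1.
pose A : {subfield K} := ASpace Vasp.
have : (<<1 & [:: e1; e2]>> <= A)%VS.
  apply/Fadjoin_seqP; split; first by rewrite sub1v.
  by move=> u; rewrite !inE => /orP[] /eqP ->; apply: memv_span; rewrite !inE eqxx ?orbT.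
rewrite full => /subvP sub v; apply/memV; apply: sub; exact: memvf.
Qed.

(** Dividing p and q by a = gcd(p, q) leaves coprime b and c, and sqrt p sqrt q / a is a square root
    of bc. *)
Lemma biquadratic_frame (p q : nat) (K : fieldExtType rat) :
  real_biquadratic p q K -> exists a b c (e1 e2 e3 : K), frame a b c e1 e2 e3.
Proof.
case=> [[p1 psq] [q1 qsq] pq [u [v [u2 v2 full]]]].
have p0 : (0 < p)%N := ltnW p1; have q0 : (0 < q)%N := ltnW q1.
pose a := gcdn p q; pose b := (p %/ a)%N; pose c := (q %/ a)%N.
have a0 : (0 < a)%N by rewrite gcdn_gt0 p0.
have pE : (a * b = p)%N by rewrite mulnC divnK // dvdn_gcdl.
have qE : (a * c = q)%N by rewrite mulnC divnK // dvdn_gcdr.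
have bc_coprime : coprime b c.
  have : (gcdn b c * a == 1 * a)%N by rewrite muln_gcdl [(b * a)%N]mulnC [(c * a)%N]mulnC pE qE mul1n.
  by rewrite eqn_pmul2r.
have aK : (a%:R : K) != 0 by have := natK_neq0 K a.-1; rewrite prednK.
pose e3 := u * v / a%:R.
have rel : frame_relations a b c u v e3.
  have uv : u * v = a%:R * e3 by rewrite /e3 [RHS]mulrC divfK.
  have ue3 : u * e3 = b%:R * v.
    apply: (mulfI aK); rewrite mulrCA -uv mulrA -expr2 u2 -pE natrM; ring.
  have ve3 : v * e3 = c%:R * u.
    apply: (mulfI aK); rewrite mulrCA -uv mulrCA -expr2 v2 -qE natrM; ring.
  split=> //; rewrite ?u2 ?v2 ?pE ?qE //.
  apply: (mulfI aK); rewrite expr2 mulrA -uv -mulrA ve3 natrM.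
  have -> : u * (c%:R * u) = c%:R * u ^+ 2 by ring.
  by rewrite u2 -pE natrM; ring.
exists a, b, c, u, v, e3; case: rel (biquadratic_span rel full) => E1 E2 E3 [E4 E5 E6] span.
split=> //.
- by rewrite pE.
- by rewrite qE.
- apply: squarefree_coprime_mul => //.
    by apply: squarefree_dvd psq; rewrite -pE dvdn_mull.
  by apply: squarefree_dvd qsq; rewrite -qE dvdn_mull.
- by move=> ab; apply: (@squarefree_neq_square p a); rewrite // -pE -ab mulnn.
- by move=> ac; apply: (@squarefree_neq_square q a); rewrite // -qE -ac mulnn.
- by move=> bc; apply: pq; rewrite -pE -qE bc.
Qed.

Theorem theorem1p1 (R : realType) (p q : nat) (K : fieldExtType rat) :
  real_biquadratic p q K ->
  exists a : 'M[K]_2, additively_indecomposable R a.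
Proof.
by case/biquadratic_frame => a [b [c [e1 [e2 [e3 F]]]]]; apply: frame_form F.
Qed.
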